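(* Let $v\le 51$ and let $(A,B)$ be a skew-symmetric $2$-$\{v;r,k;\lambda\}$ supplementary difference set such that $v$ is an odd positive integer, $4(r+k-\lambda)\ge 2$, and $2(v-2(r+k-\lambda))\ge 1$. Then $(A,B)$ is equivalent to one of the following supplementary difference sets (where $A,B\subset\mathbb{Z}_v$, and where an entry ''$B=\emptyset$ or $\{0\}$'' stands for two supplementary difference sets, the one with $B=\emptyset$ having $k=0$ and the one with $B=\{0\}$ having $k=1$): (1) $(v,r,k,\lambda)=(3,1,0,0)$: $A=\{2\}$, $B=\emptyset$. (2) $(v,r,k,\lambda)=(7,3,0,1),(7,3,1,1)$: $A=\{3,5,6\}$, $B=\emptyset$ or $\{0\}$. (3) $(v,r,k,\lambda)=(11,5,0,2),(11,5,1,2)$: $A=\{2,6,7,8,10\}$, $B=\emptyset$ or $\{0\}$. (4) $(v,r,k,\lambda)=(13,6,3,3)$: $A=\{4,7,8,10,11,12\}$, $B=\{0,2,8\}$. (5) $(v,r,k,\lambda)=(19,9,0,4),(19,9,1,4)$: $A=\{2,3,8,10,12,13,14,15,18\}$, $B=\emptyset$ or $\{0\}$. (6) $(v,r,k,\lambda)=(21,10,6,6)$: $A=\{2,3,9,11,13,14,15,16,17,20\}$, $B=\{0,1,7,9,12,17\}$. (7) $(v,r,k,\lambda)=(23,11,0,5),(23,11,1,5)$: $A=\{5,7,10,11,14,15,17,19,20,21,22\}$, $B=\emptyset$ or $\{0\}$. (8) $(v,r,k,\lambda)=(29,14,7,8)$: $A=\{4,5,6,8,9,10,12,13,15,18,22,26,27,28\}$,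 $B=\{0,1,11,13,15,18,21\}$. (9) $(v,r,k,\lambda)=(31,15,0,7),(31,15,1,7)$: $A=\{3,6,11,12,13,15,17,21,22,23,24,26,27,29,30\}$, $B=\emptyset$ or $\{0\}$. (10) $(v,r,k,\lambda)=(31,15,6,8)$: $A=\{3,6,11,12,13,15,17,21,22,23,24,26,27,29,30\}$, $B=\{0,1,15,20,22,28\}$. (11) $(v,r,k,\lambda)=(31,15,10,10)$: $A=\{4,6,7,12,16,17,18,20,21,22,23,26,28,29,30\}$, $B=\{0,1,4,5,8,11,16,18,20,29\}$. (12) $(v,r,k,\lambda)=(43,21,0,10),(43,21,1,10)$: $A=\{2,3,5,7,8,12,18,19,20,22,26,27,28,29,30,32,33,34,37,39,42\}$, $B=\emptyset$ or $\{0\}$. (13) $(v,r,k,\lambda)=(47,23,0,11),(47,23,1,11)$: $A=\{5,10,11,13,15,19,20,22,23,26,29,30,31,33,35,38,39,40,41,43,44,45,46\}$, $B=\emptyset$ or $\{0\}$.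
   Context: Let $\mathbb{Z}_v=\{0,1,\ldots,v-1\}$ be the ring of integers modulo $v$, where $v>2$. For $A\subset\mathbb{Z}_v$ and $i\in\mathbb{Z}_v$ let $P_A(i)=|\{(x,y)\in A\times A\mid y-x=i\}|$ and $P_A=(P_A(1),\ldots,P_A(v-1))$. For an $r$-subset $A$ and a $k$-subset $B$ of $\mathbb{Z}_v$ (empty sets allowed), the pair $(A,B)$ is a $2$-$\{v;r,k;\lambda\}$ supplementary difference set if $P_A+P_B=(\lambda,\lambda,\ldots,\lambda)$. Given $(A,B)$, let $R_1$ and $R_2$ be the circulant $v\times v$ $(1,-1)$-matrices with first rows $(r_{1,1},\ldots,r_{1,v})$ and $(r_{2,1},\ldots,r_{2,v})$, where $r_{1,i+1}=-1$ if $i\in A$ and $1$ if $i\notin A$, and $r_{2,i+1}=-1$ if $i\in B$ and $1$ if $i\notin B$. A $(1,-1)$-matrix $M$ is called skew-symmetric if $M-I=-(M-I)^T$. The supplementary difference set $(A,B)$ is called skew-symmetric if the matrix $\begin{pmatrix}R_1&R_2\\-R_2^T&R_1^T\end{pmatrix}$ is skew-symmetric in this sense (that is, $0\notin A$ and for each nonzero $i\in\mathbb{Z}_v$ exactly one of $i,-i$ lies in $A$). Equivalence of supplementary difference sets over $\mathbb{Z}_v$ is the equivalence relation generated by declaring $(A,B)$ equivalent to each of the following: (E0) $(\mathbb{Z}_v\setminus A,B)$ and $(A,\mathbb{Z}_v\setminus B)$; (E1) $(B,A)$; (E2) $(\pm A+a,\pm B+b)$ for any $a,b\in\mathbb{Z}_v$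 (signs chosen independently); (E3) $(dA,dB)$ for any $d\in\{1,\ldots,v-1\}$ with $\gcd(d,v)=1$. *)

(* Defs.v *)
From mathcomp Require Import all_boot all_order all_algebra.
From Stdlib Require Import Relation_Operators.

Set Implicit Arguments.
Unset Strict Implicit.
Unset Printing Implicit Defensive.

Import GRing.Theory.
Local Open Scope ring_scope.

(* Throughout, ['Z_v] is the ring of integers mod [v] only when [1 < v]. *)

Definition diff_count (v : nat) (A : {set 'Z_v}) (i : 'Z_v) : nat :=
  #|[set xy in setX A A | xy.2 - xy.1 == i]|.

Definition is_sds (v r k lambda : nat) (A B : {set 'Z_v}) : Prop :=
  [/\ #|A| = r, #|B| = k &
      forall i : 'Z_v, i != 0 ->
        (diff_count A i + diff_count B i)%N = lambda].

(* Rows and columns are indexed by ['Z_v] itself (convertible to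
   ['I_(Zp_trunc v).+2]), so [j - i] is the difference mod [v] and the row of
   index [0] is the first row. *)
Definition circulant_of (v : nat) (A : {set 'Z_v}) : 'M[int]_((Zp_trunc v).+2) :=
  \matrix_(i < (Zp_trunc v).+2, j < (Zp_trunc v).+2)
     (if ((j : 'Z_v) - (i : 'Z_v)) \in A then -1 else 1).

Definition sds_matrix (v : nat) (A B : {set 'Z_v}) :
    'M[int]_((Zp_trunc v).+2 + (Zp_trunc v).+2) :=
  block_mx (circulant_of A) (circulant_of B)
           (- (circulant_of B)^T) (circulant_of A)^T.

(* Skewness for a (1,-1)-matrix: the diagonal is 1, not 0. *)
Definition skew_symmetric_mx (n : nat) (M : 'M[int]_n) : Prop :=
  M - 1%:M = - (M - 1%:M)^T.

Definition skew_symmetric_sds (v : nat) (A B : {set 'Z_v}) : Prop :=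
  skew_symmetric_mx (sds_matrix A B).

(* The sign [s] selects [A + a] ([false]) or [- A + a] ([true]). *)
Definition signed_shift (v : nat) (s : bool) (a : 'Z_v) (A : {set 'Z_v}) :
    {set 'Z_v} :=
  [set (-1) ^+ s * x + a | x in A].

Definition dilate (v d : nat) (A : {set 'Z_v}) : {set 'Z_v} :=
  [set d%:R * x | x in A].

(* Each move is invertible and preserves being a supplementary difference set
   (for some parameters), so the relation generated on all pairs of subsets
   restricts to the one generated on supplementary difference sets. *)
Inductive sds_move (v : nat) :
    {set 'Z_v} * {set 'Z_v} -> {set 'Z_v} * {set 'Z_v} -> Prop :=
| Sds_compl_l A B : sds_move (A, B) (~: A, B)
| Sds_compl_r A B : sds_move (A, B) (A, ~: B)
| Sds_swap A B : sds_move (A, B) (B, A)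
| Sds_shift A B (s t : bool) (a b : 'Z_v) :
    sds_move (A, B) (signed_shift s a A, signed_shift t b B)
| Sds_dilate A B (d : nat) :
    (0 < d < v)%N -> coprime d v -> sds_move (A, B) (dilate d A, dilate d B).

Definition sds_equiv (v : nat) :
    {set 'Z_v} * {set 'Z_v} -> {set 'Z_v} * {set 'Z_v} -> Prop :=
  clos_refl_sym_trans _ (@sds_move v).

Definition residues (v : nat) (s : seq nat) : {set 'Z_v} :=
  [set x in [seq (n%:R : 'Z_v) | n <- s]].

(* Entries are ((v, r, k, lambda), elements of A, elements of B). *)
Definition sds_table :
    seq ((nat * nat * nat * nat) * seq nat * seq nat) :=
  [:: ((3, 1, 0, 0), [:: 2], [::]);
      ((7, 3, 0, 1), [:: 3; 5; 6], [::]);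
      ((7, 3, 1, 1), [:: 3; 5; 6], [:: 0]);
      ((11, 5, 0, 2), [:: 2; 6; 7; 8; 10], [::]);
      ((11, 5, 1, 2), [:: 2; 6; 7; 8; 10], [:: 0]);
      ((13, 6, 3, 3), [:: 4; 7; 8; 10; 11; 12], [:: 0; 2; 8]);
      ((19, 9, 0, 4), [:: 2; 3; 8; 10; 12; 13; 14; 15; 18], [::]);
      ((19, 9, 1, 4), [:: 2; 3; 8; 10; 12; 13; 14; 15; 18], [:: 0]);
      ((21, 10, 6, 6), [:: 2; 3; 9; 11; 13; 14; 15; 16; 17; 20],
         [:: 0; 1; 7; 9; 12; 17]);
      ((23, 11, 0, 5), [:: 5; 7; 10; 11; 14; 15; 17; 19; 20; 21; 22], [::]);
      ((23, 11, 1, 5), [:: 5; 7; 10; 11; 14; 15; 17; 19; 20; 21; 22], [:: 0]);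
      ((29, 14, 7, 8), [:: 4; 5; 6; 8; 9; 10; 12; 13; 15; 18; 22; 26; 27; 28],
         [:: 0; 1; 11; 13; 15; 18; 21]);
      ((31, 15, 0, 7),
         [:: 3; 6; 11; 12; 13; 15; 17; 21; 22; 23; 24; 26; 27; 29; 30], [::]);
      ((31, 15, 1, 7),
         [:: 3; 6; 11; 12; 13; 15; 17; 21; 22; 23; 24; 26; 27; 29; 30],
         [:: 0]);
      ((31, 15, 6, 8),
         [:: 3; 6; 11; 12; 13; 15; 17; 21; 22; 23; 24; 26; 27; 29; 30],
         [:: 0; 1; 15; 20; 22; 28]);
      ((31, 15, 10, 10),
         [:: 4; 6; 7; 12; 16; 17; 18; 20; 21; 22; 23; 26; 28; 29; 30],
         [:: 0; 1; 4; 5; 8; 11; 16; 18; 20; 29]);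
      ((43, 21, 0, 10),
         [:: 2; 3; 5; 7; 8; 12; 18; 19; 20; 22; 26; 27; 28; 29; 30; 32; 33; 34;
             37; 39; 42], [::]);
      ((43, 21, 1, 10),
         [:: 2; 3; 5; 7; 8; 12; 18; 19; 20; 22; 26; 27; 28; 29; 30; 32; 33; 34;
             37; 39; 42], [:: 0]);
      ((47, 23, 0, 11),
         [:: 5; 10; 11; 13; 15; 19; 20; 22; 23; 26; 29; 30; 31; 33; 35; 38; 39;
             40; 41; 43; 44; 45; 46], [::]);
      ((47, 23, 1, 11),
         [:: 5; 10; 11; 13; 15; 19; 20; 22; 23; 26; 29; 30; 31; 33; 35; 38; 39;
             40; 41; 43; 44; 45; 46], [:: 0])]%N.

(* Main.v *)
(** Let [S x = [x in A] - [-x in A]] be the sign function of a skew set [A] and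
  let [n = r + k - lambda].  The supplementary difference property says that the
  autocorrelations of [S] and of the indicator of [B] satisfy
  [auto S d + 4 auto B d = c + (4n - 1) [d = 0]] for a constant [c], so every
  nontrivial Fourier coefficient of [S] has squared modulus at most [4n - 1].
  Rounding the real characters to integer weights turns this into finitely many
  linear inequalities [|sum_j S_j W_j| <= lim] on the [v/2] signs of [A], and a
  verified branch and bound enumeration shows that up to dilation [A] is one of
  the few tabulated sets.  Given [A], the set [B] has prescribed difference
  counts, and a second verified search determines it up to translation.

  Two cases escape the searches.  For [v = 51] and [B] empty, pushing [S]
  forward to [Z/3] would make 17 a square.  For the parameters [(43; 21, 15; 15)]
  the difference counts of [B] are known but the search for [B] is too long:
  when [A] is the Paley set these counts are all odd, which is impossible since
  2 is self-conjugate modulo 43; when [A] is the exceptional set, some Fourier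
  coefficient of the counts has odd valuation at a prime of the real subfield
  that is inert in the cyclotomic field, whereas it should be a relative norm. *)

From Stdlib Require Import ZArith Relation_Operators.
Require Import Defs.
From mathcomp Require Import all_boot all_order all_algebra.
From mathcomp Require Import zify ssrZ ring.

Set Implicit Arguments.
Unset Strict Implicit.
Unset Printing Implicit Defensive.

Import Order.TTheory GRing.Theory Num.Theory.
Local Open Scope ring_scope.

(** * Correlations and the spectral bound *)

Section Correlation.
Variables (G : finZmodType) (R : realDomainType).
Implicit Types f g h : G -> R.

Definition autocorr f d := \sum_x f x * f (x + d).

(** Lagrange's identity: the double sum of [(f x * g y - f y * g x) ^+ 2] is twice the difference of
    the two sides. *)
Lemma cauchy_schwarz f g :
  (\sum_x f x * g x) ^+ 2 <= (\sum_x f x ^+ 2) * (\sum_x g x ^+ 2).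
Proof.
have : 0 <= \sum_x \sum_y (f x * g y - f y * g x) ^+ 2.
  by apply: sumr_ge0 => x _; apply: sumr_ge0 => y _; exact: sqr_ge0.
have -> : \sum_x \sum_y (f x * g y - f y * g x) ^+ 2 =
    \sum_x \sum_y (f x ^+ 2 * g y ^+ 2) + \sum_x \sum_y (g x ^+ 2 * f y ^+ 2)
    - 2 * \sum_x \sum_y ((f x * g x) * (f y * g y)).
  rewrite mulr_sumr -!big_split /= -sumrB; apply: eq_bigr => x _.
  rewrite mulr_sumr -!big_split /= -sumrB; apply: eq_bigr => y _; ring.
rewrite -!big_distrlr /=; set a := \sum_x f x ^+ 2; set b := \sum_x g x ^+ 2.
set c := \sum_x f x * g x.
have -> : a * b + b * a - 2 * (c * c) = 2 * (a * b - c ^+ 2) by ring.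
by rewrite pmulr_rge0 ?ltr0n // subr_ge0.
Qed.

(** Plancherel without characters: expand the square and group the pairs [(y, z)] by [d = z - y]. *)
Lemma sum_conv_sqr f g :
  \sum_x (\sum_y f y * g (x - y)) ^+ 2 = \sum_d autocorr f d * autocorr g d.
Proof.
under eq_bigr => x _ do rewrite expr2 big_distrlr /=.
rewrite exchange_big /=.
under eq_bigr => y _.
  rewrite exchange_big /=.
  rewrite (reindex_inj (addrI y)) /=.
  over.
rewrite exchange_big /=; apply: eq_bigr => d _.
rewrite /autocorr big_distrl /=; apply: eq_bigr => y _.
rewrite mulr_sumr (reindex_inj (addrI (y + d))) /=; apply: eq_bigr => x _.
have -> : y + d + x - y = x + d by rewrite addrAC [y + d]addrC addrK addrC.
by rewrite [y + d + x]addrC addrK; ring.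
Qed.

Lemma autocorr_ge f : \sum_d autocorr f d = (\sum_x f x) ^+ 2.
Proof.
rewrite /autocorr exchange_big /= expr2 big_distrl /=; apply: eq_bigr => x _.
by rewrite -mulr_sumr [in RHS](reindex_inj (addrI x)).
Qed.

(* Convolving with a mean-zero [g] removes the constant [c], and the contribution
  of [b] is a sum of squares. *)
Lemma psd_bound (S b : G -> R) (c n : R) g h :
  (forall d, autocorr S d + 4 * autocorr b d = c + n *+ (d == 0)) ->
  \sum_x g x = 0 ->
  (\sum_y S y * \sum_x h x * g (x - y)) ^+ 2
    <= n * (\sum_x g x ^+ 2) * (\sum_x h x ^+ 2).
Proof.
move=> Hc Hg.
have -> : \sum_y S y * \sum_x h x * g (x - y) =
          \sum_x h x * \sum_y S y * g (x - y).
  under eq_bigr => y _ do rewrite mulr_sumr.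
  rewrite exchange_big /=; apply: eq_bigr => x _.
  by rewrite mulr_sumr; apply: eq_bigr => y _; ring.
apply: (le_trans (cauchy_schwarz _ _)); rewrite mulrC.
apply: ler_wpM2r; first by apply: sumr_ge0 => x _; exact: sqr_ge0.
have Hb : 0 <= \sum_x (\sum_y b y * g (x - y)) ^+ 2.
  by apply: sumr_ge0 => x _; exact: sqr_ge0.
suff E : \sum_x (\sum_y S y * g (x - y)) ^+ 2 +
   4 * \sum_x (\sum_y b y * g (x - y)) ^+ 2 = n * \sum_x g x ^+ 2.
  by rewrite -E lerDl mulr_ge0 ?ler0n.
rewrite !sum_conv_sqr mulr_sumr -big_split /=.
under eq_bigr => d _ do rewrite mulrA -mulrDl Hc mulrDl.
rewrite big_split /= -mulr_sumr autocorr_ge Hg expr0n mulr0 add0r.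
rewrite (bigD1 0) //= eqxx big1 ?addr0 => [|d /negbTE ->]; last by rewrite mul0r.
by congr (_ * _); apply: eq_bigr => x _; rewrite addr0 expr2.
Qed.

End Correlation.

(** * The sign function of a skew set and its autocorrelation *)

Section SkewSets.
Variable G : finZmodType.
Implicit Types (A B : {set G}) (R : realDomainType).

Definition skew_set A := 0 \notin A /\ forall x, x != 0 -> (- x \in A) = (x \notin A).

Definition indic (R : realDomainType) A (x : G) : R := (x \in A)%:R.
Definition skew_sign (R : realDomainType) A (x : G) : R := indic R A x - indic R A (- x).

Definition corr A (d : G) := #|[set x in A | x + d \in A]|.

Lemma autocorr_indic R A d : autocorr (indic R A) d = (corr A d)%:R.
Proof.
rewrite /autocorr /corr -sum1_card natr_sum [RHS]big_mkcond /=.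
apply: eq_bigr => x _; rewrite inE /indic -natrM mulnb.
by case: (_ && _).
Qed.

Lemma corr0 A : corr A 0 = #|A|.
Proof. by apply: eq_card => x; rewrite inE addr0 andbb. Qed.

Lemma sum_indic R A : \sum_x indic R A x = #|A|%:R.
Proof.
rewrite -sum1_card natr_sum [RHS]big_mkcond /=; apply: eq_bigr => x _.
by rewrite /indic; case: (_ \in _).
Qed.

Lemma skew_signN R A x : skew_sign R A (- x) = - skew_sign R A x.
Proof. by rewrite /skew_sign opprK opprB. Qed.

Lemma skew_signE R A x : skew_set A ->
  skew_sign R A x = indic R A x *+ 2 - 1 + (x == 0)%:R.
Proof.
move=> [A0 AN]; rewrite /skew_sign /indic; case: (eqVneq x 0) => [->|x0].
  by rewrite oppr0 (negbTE A0) subrr mul0rn add0r addNr.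
by rewrite AN //; case: (x \in A); rewrite /= ?mulr2n ?addrK ?subr0 ?addr0 ?sub0r.
Qed.

Lemma sum_delta (R : realDomainType) (f : G -> R) d :
  \sum_x f x * (x + d == 0)%:R = f (- d).
Proof.
rewrite (bigD1 (- d)) //= addNr eqxx mulr1 big1 ?addr0 // => x xd.
by rewrite addr_eq0 (negbTE xd) mulr0.
Qed.

(** Expand both factors by [skew_signE]. For [d != 0] the terms in which one factor is the delta at
    0 add up to [2 (1_A(d) + 1_A(-d)) - 2], which vanishes because exactly one of [d], [-d] lies in
    [A]. *)
Lemma autocorr_skew R A d : skew_set A ->
  autocorr (skew_sign R A) d =
    if d == 0 then #|G|%:R - 1 else (corr A d)%:R *+ 4 - #|A|%:R *+ 4 + #|G|%:R.
Proof.
move=> skA; case: (eqVneq d 0) => [->|d0].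
  rewrite /autocorr; under eq_bigr => x _.
    have -> : skew_sign R A x * skew_sign R A (x + 0) = 1 - (x + 0 == 0)%:R.
      rewrite addr0; case: (eqVneq x 0) => [->|x0].
        by rewrite /skew_sign oppr0 !subrr mul0r.
      rewrite skew_signE // (negbTE x0) addr0 subr0 /indic.
      by case: (_ \in _) => /=; ring.
    over.
  rewrite sumrB sumr_const; congr (_ - _).
  by under eq_bigr => x _ do rewrite -[(_ == _)%:R]mul1r; rewrite sum_delta.
have [A0 AN] := skA.
rewrite /autocorr; under eq_bigr => x _ do rewrite !skew_signE //.
pose i := indic R A.
have -> : \sum_(x : G) (i x *+ 2 - 1 + (x == 0)%:R) * (i (x + d) *+ 2 - 1 + (x + d == 0)%:R) =
   autocorr i d *+ 4 - (\sum_(x : G) i x) *+ 2 - (\sum_(x : G) i (x + d)) *+ 2 + #|G|%:R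
   + (\sum_(x : G) (i x * (x + d == 0)%:R)) *+ 2 + (\sum_(x : G) (i (x + d) * (x + 0 == 0)%:R)) *+ 2
   - \sum_(x : G) (1 * (x + d == 0)%:R) - \sum_(x : G) (1 * (x + 0 == 0)%:R)
   + \sum_(x : G) ((x + 0 == 0)%:R * (x + d == 0)%:R).
  have -> : #|G|%:R = \sum_(x : G) 1 :> R by rewrite sumr_const.
  rewrite /autocorr -!sumrMnl -2!sumrB -!big_split -2!sumrB -big_split /=.
  by apply: eq_bigr => x _; rewrite !addr0; ring.
rewrite !sum_delta autocorr_indic oppr0 add0r.
have -> : \sum_x i (x + d) = \sum_x i x by rewrite [RHS](reindex_inj (addIr d)).
rewrite addr0 oppr_eq0 (negbTE d0) /i sum_indic /indic AN //.
by case: (d \in A); rewrite /=; ring.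
Qed.

End SkewSets.

(** * Translation of the definitions over the residues modulo [v] *)

Lemma diff_countE v (A : {set 'Z_v}) i : diff_count A i = corr A i.
Proof.
rewrite /diff_count /corr -(card_imset (mem [set x in A | x + i \in A]) (f := fun x => (x, x + i))).
  apply: eq_card => -[x y]; rewrite !inE /=; apply/andP/imsetP => [[/andP[xA yA] /eqP <-]|].
    by exists x; rewrite ?inE addrC subrK // xA.
  by move=> [z]; rewrite inE => /andP[zA ziA] [-> ->]; rewrite zA ziA addrC addKr.
by move=> x y [].
Qed.

(** Only the upper left block is read: its corner entry gives [0 \notin A], the rest of its first
    row the condition on [x] and [- x]. *)
Lemma skew_symmetric_sdsE v (A B : {set 'Z_v}) : skew_symmetric_sds A B -> skew_set A.
Proof.
move=> /matrixP H.
have E (i j : 'Z_v) : (if j - i \in A then -1 else 1) - (i == j)%:R =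
   - ((if i - j \in A then -1 else 1) - (i == j)%:R) :> int.
  have := H (lshift _ i) (lshift _ j).
  rewrite mxE [in X in _ = X]mxE [in X in _ = X]mxE [in X in _ = X]mxE.
  rewrite [(- 1%:M) _ _]mxE [(- 1%:M) _ _]mxE ![1%:M _ _]mxE !block_mxEul ![circulant_of A _ _]mxE.
  by rewrite !eq_lshift [j == i]eq_sym.
split.
  by have := E 0 0; rewrite subrr eqxx; case: (0 \in A) => // /eqP.
move=> x x0; have := E 0 x; rewrite subr0 sub0r eq_sym (negbTE x0) !subr0.
by case: (x \in A); case: (- x \in A) => // /eqP.
Qed.

Lemma card_Zv v : (1 < v)%N -> #|'Z_v| = v.
Proof. by move=> hv; rewrite card_ord Zp_cast. Qed.

Lemma sds_autocorr (R : realDomainType) v r k l (A B : {set 'Z_v}) : (1 < v)%N ->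
  is_sds r k l A B -> skew_set A ->
  forall d, autocorr (skew_sign R A) d + 4 * autocorr (indic R B) d =
    l%:R *+ 4 - r%:R *+ 4 + v%:R + (r%:R *+ 4 + k%:R *+ 4 - l%:R *+ 4 - 1) *+ (d == 0).
Proof.
move=> hv [cA cB H] skA d; rewrite autocorr_skew // autocorr_indic card_Zv // cA.
case: (eqVneq d 0) => [->|d0]; first by rewrite corr0 cB mulr1n; ring.
by rewrite -(H d d0) !diff_countE natrD mulr0n; ring.
Qed.

(** * Enumeration of the skew sets *)

(* A node is a shared decision diagram on the remaining signs: [Leaf] is reached
  by the sign strings satisfying a fixed linear inequality, and [Dead] as soon as
  the inequality is violated.  Sharing comes from [budget_table], whose entry
  [i] accepts the strings whose [cost] lies in the window (i - width, i]. *)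
Inductive node := Dead | Leaf | Fork of node & node.

Definition pos_child n := if n is Fork p _ then p else Dead.
Definition neg_child n := if n is Fork _ q then q else Dead.

Fixpoint forks (l1 l2 : seq node) : seq node :=
  if l1 is p :: l1' then if l2 is q :: l2' then Fork p q :: forks l1' l2' else [::]
  else [::].

Fixpoint budget_table (width : nat) (ws : seq (bool * nat)) : seq node :=
  if ws is (s, w) :: ws' then
    let T := budget_table width ws' in
    let keep := T ++ nseq w Dead in let pay := nseq w Dead ++ T in
    if s then forks keep pay else forks pay keep
  else nseq width Leaf.

Fixpoint cost (bits : seq bool) (ws : seq (bool * nat)) : nat :=
  if (bits, ws) is (b :: bits', (s, w) :: ws')
  then ((if b == s then 0 else w) + cost bits' ws')%N else 0%N.

Definition weight (ws : seq (bool * nat)) := sumn (unzip2 ws).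

Fixpoint follow (n : node) (bits : seq bool) : node :=
  if bits is b :: bits' then follow ((if b then pos_child else neg_child) n) bits' else n.

Lemma size_forks l1 l2 : size (forks l1 l2) = minn (size l1) (size l2).
Proof. by elim: l1 l2 => [|p l1 IH] [|q l2] //=; rewrite IH minnSS. Qed.

Lemma nth_forks l1 l2 i : (i < minn (size l1) (size l2))%N ->
  nth Dead (forks l1 l2) i = Fork (nth Dead l1 i) (nth Dead l2 i).
Proof.
elim: l1 l2 i => [|p l1 IH] [|q l2] [|i] //=; rewrite ?ltn0 ?min0n ?minn0 //.
by rewrite minnSS ltnS => /IH.
Qed.

Lemma size_budget_table width ws : size (budget_table width ws) = (width + weight ws)%N.
Proof.
rewrite /weight; elim: ws => [|[s w] ws IH] /=; first by rewrite size_nseq addn0.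
by case: s; rewrite size_forks !size_cat size_nseq IH; lia.
Qed.

Lemma cost_weight bits ws : (cost bits ws <= weight ws)%N.
Proof.
rewrite /weight; elim: ws bits => [|[s w] ws IH] [|b bits] //=.
by have := IH bits; case: (b == s); lia.
Qed.

(** The index is the budget left: paying [w] moves from entry [i] to entry [i - w] of the shorter
    table, and the [Dead] padding stands for budgets out of range. *)
Lemma follow_budget_table width ws bits i : size bits = size ws ->
  (cost bits ws <= i)%N -> (i < cost bits ws + width)%N ->
  follow (nth Dead (budget_table width ws) i) bits = Leaf.
Proof.
elim: ws bits i => [|[s w] ws IH] [|b bits] i //=.
  by rewrite add0n => _ _ iw; rewrite nth_nseq iw.
move=> [Hs] Hle Hlt; have Hc := cost_weight bits ws.
set T := budget_table width ws in IH *.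
have szT : size T = (width + weight ws)%N by exact: size_budget_table.
have Hi : (i < size T + w)%N by rewrite szT; case: (b == s) Hle Hlt; lia.
have keepE : nth Dead (T ++ nseq w Dead) i = nth Dead T i.
  by rewrite nth_cat; case: ltnP => // Ti; rewrite nth_nseq if_same nth_default.
have payE : (w <= i)%N -> nth Dead (nseq w Dead ++ T) i = nth Dead T (i - w).
  by move=> wi; rewrite nth_cat size_nseq ltnNge wi.
have szs : (i < minn (size (T ++ nseq w Dead)) (size (nseq w Dead ++ T)))%N.
  by rewrite !size_cat size_nseq addnC minnn addnC.
case: s b Hle Hlt => -[] /= Hle Hlt; rewrite nth_forks //= 1?minnC //= ?keepE ?payE;
  try lia; apply: IH => //; lia.
Qed.

(** * Branch and bound over sign strings *)

Fixpoint some_dead (ns : seq node) : bool :=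
  if ns is n :: ns' then if n is Dead then true else some_dead ns' else false.

Fixpoint split_forks (ns : seq node) : option (seq node * seq node) :=
  if ns is n :: ns' then
    if n is Fork p q then
      if split_forks ns' is Some (ps, qs) then Some (p :: ps, q :: qs) else None
    else None
  else Some ([::], [::]).

(** Only a [Fork] can reach [Leaf] along a nonempty string, so a failed split means that no
    continuation satisfies all inequalities and the branch may be pruned. *)
Lemma split_forksP ns b bits : (forall n, List.In n ns -> follow n (b :: bits) = Leaf) ->
  exists ps qs, split_forks ns = Some (ps, qs) /\
    forall n, List.In n (if b then ps else qs) -> follow n bits = Leaf.
Proof.
have follow_dead : follow Dead bits = Dead by elim: bits => //= -[].
elim: ns => [|n ns IH] H /=; first by exists [::], [::]; case: b {H}.
have [|ps [qs [-> Hpq]]] := IH; first by move=> m min; apply: H; right.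
have := H n (or_introl (erefl n)); case: n {H} => [||p q] /=; try by case: (b); rewrite follow_dead.
move=> E; exists (p :: ps), (q :: qs); split=> // m.
by case: (b) Hpq E => Hpq E [<-|/Hpq].
Qed.

Section Search.
Variable accept : seq bool -> bool.

Fixpoint search (t : nat) (ns : seq node) (path : seq bool) : bool :=
  if t is t'.+1 then
    if split_forks ns is Some (ps, qs) then
      if search t' ps (true :: path) then search t' qs (false :: path) else false
    else true
  else if some_dead ns then true else accept (rev path).

Lemma some_dead_in ns : some_dead ns -> List.In Dead ns.
Proof. by elim: ns => //= n ns IH; case: n => [_|/IH|? ? /IH]; [left|right|right]. Qed.

(** A string satisfying every inequality never enters a pruned branch, so [accept] was evaluated on
    it; [path] holds the earlier signs in reverse order. *)
Lemma search_sound t ns path bits : search t ns path -> size bits = t ->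
  (forall n, List.In n ns -> follow n bits = Leaf) -> accept (catrev path bits).
Proof.
elim: t ns path bits => [|t IH] ns path [|b bits] //=.
  by case: ifP => // Hd _ _ /(_ _ (some_dead_in Hd)).
move=> + [Hs] Hn; have [ps [qs [-> Hpq]]] := split_forksP Hn.
case: ifP => // Hp Hq; have step : search t (if b then ps else qs) (b :: path) by case: (b).
exact: IH step Hs Hpq.
Qed.

End Search.

Definition signed_weight (z : Z) := (Z.leb Z0 z, Z.abs_nat z).

(* [signed_sum bits W = weight - 2 * cost], so [|signed_sum| <= lim] is a window of
  [lim + 1] consecutive costs. *)
Definition root (lim : nat) (W : seq Z) : node :=
  let ws := map signed_weight W in
  nth Dead (budget_table lim.+1 ws) (weight ws + lim)./2.

Definition signed_sum (bits : seq bool) (W : seq Z) : Z :=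
  foldr (fun p a => Z.add (if p.1 then p.2 else Z.opp p.2) a) Z0 (zip bits W).

Lemma signed_sumE bits W : size bits = size W ->
  signed_sum bits W =
  Z.of_nat (weight (map signed_weight W)) - (Z.of_nat (cost bits (map signed_weight W))) *+ 2.
Proof.
rewrite /weight /signed_sum; elim: W bits => [|z W IH] [|b bits] //= [/IH ->].
by case: b; case: (Z.leb_spec0 Z0 z) => /= hz; lia.
Qed.

Lemma follow_root lim W bits : size bits = size W ->
  `|signed_sum bits W| <= Z.of_nat lim -> follow (root lim W) bits = Leaf.
Proof.
move=> szb; rewrite signed_sumE // => H.
by rewrite /root; apply: follow_budget_table; rewrite ?size_map //; lia.
Qed.

(** * Integer weights approximating characters *)

Definition zsum (F : nat -> Z) (s : seq nat) : Z := foldr (fun x a => Z.add (F x) a) Z0 s.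

Definition periodic (g : seq Z) (x : nat) : Z := nth Z0 g (x %% size g).

(* The coefficient of the sign of [y] in [\sum_y S y * \sum_x h x * g (x - y)],
  since [S] is odd. *)
Definition odd_corr (v : nat) (g h : seq Z) (y : nat) : Z :=
  zsum (fun x => Z.mul (periodic h x)
                   (Z.sub (periodic g (x + (v - y))) (periodic g (x + y)))) (iota 0 v).

Definition energy (v : nat) (g : seq Z) : Z :=
  zsum (fun x => Z.mul (periodic g x) (periodic g x)) (iota 0 v).

Definition weights (v : nat) (K : Z) (g h : seq Z) : seq Z :=
  [seq Z.div (Z.add (odd_corr v g h y) (Z.div2 K)) K | y <- iota 1 v./2].

Definition rounding_error (v : nat) (K : Z) (g h : seq Z) (W : seq Z) : Z :=
  zsum (fun j => Z.abs (Z.sub (odd_corr v g h j.+1) (Z.mul K (nth Z0 W j)))) (iota 0 v./2).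

(* [W] is [odd_corr] divided by [K] and rounded; the rounding errors, at most [E] in
  total, are charged to the bound [lim]. *)
Definition valid_bound (v : nat) (N K : Z) (g h W : seq Z) (lim : nat) : bool :=
  let E := rounding_error v K g h W in
  let b := Z.sub (Z.mul K (Z.of_nat lim.+1)) E in
  [&& (size g %| v)%N, (size h %| v)%N & Z.eqb (zsum (periodic g) (iota 0 v)) Z0] &&
  [&& Z.leb Z0 b, Z.ltb Z0 K &
      Z.ltb (Z.mul N (Z.mul (energy v g) (energy v h))) (Z.mul b b)].

(** [W] lists the weights of the residues [1, ..., v./2], so the weight of [x] stands at index
    [x - 1]. *)
Definition odd_ext (v : nat) (W : seq Z) (x : nat) : Z :=
  if x is x'.+1 then
    if (x' < v./2)%N then nth Z0 W x' else Z.opp (nth Z0 W (v - x).-1)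
  else Z0.

Definition dilated_row (v : nat) (W : seq Z) (u : nat) : seq Z :=
  [seq odd_ext v W ((u * j) %% v) | j <- iota 1 v./2].

Lemma zsumE F s : zsum F s = \sum_(x <- s) F x.
Proof. by elim: s => [|x s IH]; rewrite ?big_nil // big_cons -IH. Qed.

(** * Sums over all residues reduced to half of them *)

Section HalfSums.
Variable v : nat.
Hypotheses (v_gt1 : (1 < v)%N) (v_odd : odd v).
Implicit Types F S : 'Z_v -> Z.

Lemma sum_ZvE (R : nmodType) (F : 'Z_v -> R) : \sum_y F y = \sum_(0 <= j < v) F j%:R.
Proof.
rewrite big_mkord; have H n : n = (Zp_trunc v).+2 -> \sum_y F y = \sum_(i < n) F i%:R.
  by move=> ->; apply: eq_bigr => i _; rewrite natr_Zp.
by apply: H; rewrite Zp_cast.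
Qed.

Lemma natrN_Zv j : (j <= v)%N -> (v - j)%:R = - j%:R :> 'Z_v.
Proof. by move=> jv; rewrite natrB // char_Zp // sub0r. Qed.

Lemma sum_Zv_half F : F 0 = 0 -> (forall y, F (- y) = F y) ->
  \sum_y F y = (\sum_(1 <= j < v./2.+1) F j%:R) *+ 2.
Proof.
move=> F0 FN; have vE : v = (v./2.*2).+1 by rewrite -[LHS]odd_double_half v_odd.
rewrite sum_ZvE big_ltn ?(ltnW v_gt1) // F0 add0r.
rewrite (@big_cat_nat _ _ _ v./2.+1) //=; last by lia.
rewrite mulr2n; congr (_ + _).
rewrite big_nat_rev /= -{1}[v./2.+1]add1n big_addn.
have -> : (v - v./2 = v./2.+1)%N by lia.
rewrite [in LHS]big_nat [in RHS]big_nat; apply: eq_bigr => i /andP[i1 i2].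
rewrite -[RHS]FN -natrN_Zv; last by lia.
by congr (F _%:R); lia.
Qed.

(** An odd [S] sees only the odd part of [F]; doubling the sum and reindexing by negation makes the
    summand even. *)
Lemma sum_odd_half S F : (forall y, S (- y) = - S y) ->
  \sum_y S y * F y = \sum_(1 <= j < v./2.+1) S j%:R * (F j%:R - F (- j%:R)).
Proof.
move=> SN; have S0 : S 0 = 0.
  by have := SN 0; rewrite oppr0; move: (S 0) => s; lia.
have E : (\sum_y S y * F y) *+ 2 = \sum_y S y * (F y - F (- y)).
  rewrite mulr2n {2}(reindex_inj oppr_inj) /= -big_split /=.
  by apply: eq_bigr => y _; rewrite SN; ring.
have := @sum_Zv_half (fun y => S y * (F y - F (- y))).
rewrite S0 mul0r -E => /(_ erefl) H.
have /H : forall y, S (- y) * (F (- y) - F (- - y)) = S y * (F y - F (- y)).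
  by move=> y; rewrite SN opprK; ring.
by set a := \sum_y _; set b := \sum_(1 <= _ < _) _; move: a b; lia.
Qed.

End HalfSums.

Definition sign_bits v (A : {set 'Z_v}) : seq bool := [seq j%:R \in A | j <- iota 1 v./2].

(** * The linear inequalities on the signs of a skew set *)

Section LinearBound.
Variables (v : nat) (N : Z).
Hypotheses (v_gt1 : (1 < v)%N) (v_odd : odd v).
Variables (S b : 'Z_v -> Z) (c n : Z).
Hypotheses (SN : forall y, S (- y) = - S y) (S1 : forall y, y != 0 -> `|S y| = 1).
Hypothesis Sb : forall d, autocorr S d + 4 * autocorr b d = c + n *+ (d == 0).
Hypothesis n_le : n <= N.

Lemma val_natr_Zv j : nat_of_ord (j%:R : 'Z_v) = (j %% v)%N.
Proof. exact: val_Zp_nat. Qed.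

Lemma val_addr_Zv (x y : 'Z_v) : nat_of_ord (x + y) = ((x + y) %% v)%N.
Proof. by rewrite -[x in LHS]natr_Zp -[y in LHS]natr_Zp -natrD val_natr_Zv. Qed.

Lemma periodicE (g : seq Z) j : (size g %| v)%N -> periodic g (j%:R : 'Z_v) = periodic g j.
Proof. by move=> gv; rewrite /periodic val_natr_Zv modn_dvdm. Qed.

Lemma sum_periodic (F : Z -> Z) (g : seq Z) : (size g %| v)%N ->
  \sum_(x : 'Z_v) F (periodic g x) = \sum_(x <- iota 0 v) F (periodic g x).
Proof.
move=> gv; rewrite (sum_ZvE v_gt1) /index_iota subn0.
by apply: eq_bigr => j _; rewrite periodicE.
Qed.

Lemma nonzero_small j : (0 < j < v)%N -> j%:R != 0 :> 'Z_v.
Proof.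
move=> /andP[j0 jv]; apply/eqP => /(congr1 (@nat_of_ord _)).
by rewrite val_natr_Zv modn_small //= => jE; rewrite jE in j0.
Qed.

Lemma odd_corrE g h j : (size g %| v)%N -> (size h %| v)%N -> (0 < j < v)%N ->
  let w (y : 'Z_v) := \sum_(x : 'Z_v) periodic h x * periodic g (x - y)%R in
  w j%:R - w (- j%:R) = odd_corr v g h j.
Proof.
move=> gv hv jv w; rewrite /w -sumrB /odd_corr zsumE (sum_ZvE v_gt1) /index_iota subn0.
apply: eq_bigr => x _; cbv beta; rewrite opprK -natrN_Zv //; last by lia.
by rewrite -!natrD !periodicE // -mulrBr.
Qed.

(** The exact correlation [T] satisfies [T ^+ 2 <= N * energy g * energy h] and differs from [K * L]
    by at most the rounding error [E], where [L] is the rounded sum. If [|L| >= lim + 1], then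
    [|T| >= K * (lim + 1) - E], which contradicts [valid_bound]. *)
Lemma linear_bound K (g h W : seq Z) lim : size W = v./2 ->
  valid_bound v N K g h W lim ->
  `|\sum_(0 <= j < v./2) S j.+1%:R * nth Z0 W j| <= Z.of_nat lim.
Proof.
move=> szW /andP[/and3P[gv hv /Z.eqb_spec sg] /and3P[b0 K0 lt]].
have {}lt : N * (energy v g * energy v h) <
    (K * Z.of_nat lim.+1 - rounding_error v K g h W) ^+ 2 := lt.
have {}b0 : 0 <= K * Z.of_nat lim.+1 - rounding_error v K g h W := b0.
have {}K0 : 0 < K := K0.
have := psd_bound (fun x : 'Z_v => periodic h x) Sb (g := fun x : 'Z_v => periodic g x).
rewrite (sum_periodic id) // -zsumE sg => /(_ erefl).
rewrite (sum_odd_half v_gt1 v_odd) // big_add1 /=.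
rewrite big_nat; under eq_bigr => j /andP[_ jv].
  rewrite odd_corrE //; last by lia.
  over.
rewrite -big_nat (sum_periodic (fun z => z ^+ 2)) // (sum_periodic (fun z => z ^+ 2)) //.
set T := \sum_(0 <= j < _) _.
have -> : \sum_(x <- iota 0 v) periodic g x ^+ 2 = energy v g by rewrite /energy zsumE.
have -> : \sum_(x <- iota 0 v) periodic h x ^+ 2 = energy v h by rewrite /energy zsumE.
have e0 f : 0 <= energy v f.
  by rewrite /energy zsumE; apply: sumr_ge0 => x _; exact: (@sqr_ge0 Z (periodic f x)).
move=> T2; have {}T2 : T ^+ 2 <= N * (energy v g * energy v h).
  by apply: (le_trans T2); rewrite -mulrA ler_wpM2r // mulr_ge0.
set L := \sum_(0 <= j < _) _.
have TL : `|T - K * L| <= rounding_error v K g h W.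
  rewrite /T /L mulr_sumr -sumrB; apply: (le_trans (ler_norm_sum _ _ _)).
  rewrite /rounding_error zsumE /index_iota subn0.
  rewrite [leLHS]big_seq [leRHS]big_seq; apply: ler_sum => j; rewrite mem_iota => /andP[_ jv].
  rewrite mulrCA -mulrBr normrM S1 ?mul1r; first exact: lexx.
  by apply: nonzero_small; lia.
move: TL lt b0 T2; set E := rounding_error _ _ _ _ _; set Q := N * _.
set M := Z.of_nat lim.+1 => TL lt b0 T2; rewrite leNgt; apply/negP => Ll.
have Ll1 : M <= `|L| by move: Ll; rewrite /M; move: `|L|; lia.
have KL : K * M <= `|K * L| by rewrite normrM (gtr0_norm K0) ler_wpM2l // ltW.
have bT : K * M - E <= `|T|.
  rewrite lerBlDr (le_trans KL) // -lerBlDl (le_trans _ TL) //.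
  by rewrite distrC lerB_dist.
have H : (K * M - E) ^+ 2 <= T ^+ 2.
  by rewrite -[leRHS]real_normK ?num_real // ler_sqr ?nnegrE // (le_trans b0).
by have := lt_le_trans lt (le_trans H T2); rewrite ltxx.
Qed.

End LinearBound.

Section DilatedBound.
Variables (v : nat) (N : Z).
Hypotheses (v_gt1 : (1 < v)%N) (v_odd : odd v).
Variables (S b : 'Z_v -> Z) (c n : Z).
Hypotheses (SN : forall y, S (- y) = - S y) (S1 : forall y, y != 0 -> `|S y| = 1).
Hypothesis Sb : forall d, autocorr S d + 4 * autocorr b d = c + n *+ (d == 0).
Hypothesis n_le : n <= N.

Lemma odd_ext_small W j : (j < v./2)%N -> odd_ext v W (j.+1%:R : 'Z_v) = nth Z0 W j.
Proof.
move=> jv; rewrite val_natr_Zv // modn_small /= ?jv //; lia.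
Qed.

Lemma odd_extN W (y : 'Z_v) : odd_ext v W (- y)%R = - odd_ext v W y.
Proof.
rewrite -[y]natr_Zp; have : (y < v)%N by rewrite -[X in (_ < X)%N]Zp_cast.
move: (nat_of_ord y) => j jv.
rewrite -natrN_Zv ?(ltnW jv) // !val_natr_Zv // [(j %% v)%N]modn_small //.
case: j jv => [|j] jv; first by rewrite subn0 modnn.
rewrite modn_small; last by lia.
have -> : (v - j.+1 = (v - j.+1).-1.+1)%N by lia.
rewrite /=; case: ltnP => j1; case: ltnP => j2; try lia.
by congr (Z.opp (nth _ _ _)); lia.
Qed.

(** Dilating by a unit permutes the autocorrelations and fixes the one at 0, so the undilated bound
    applies to the dilated [S]; reindexing then moves the dilation onto the weights. *)
Lemma dilated_bound K (g h W : seq Z) lim u : size W = v./2 -> coprime v u ->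
  valid_bound v N K g h W lim ->
  `|\sum_(0 <= j < v./2) S j.+1%:R * nth Z0 (dilated_row v W u) j| <= Z.of_nat lim.
Proof.
move=> szW cu vb; have Uu : (u%:R : 'Z_v) \is a GRing.unit by rewrite unitZpE.
set U : 'Z_v := u%:R in Uu.
pose dil (f : 'Z_v -> Z) y := f (U^-1 * y).
have Ui : injective ( *%R U) by exact: mulrI.
have acE f d : autocorr (dil f) d = autocorr f (U^-1 * d).
  rewrite /autocorr (reindex_inj Ui); apply: eq_bigr => x _.
  by rewrite /dil mulrDr mulKr.
have SN' y : dil S (- y) = - dil S y by rewrite /dil mulrN SN.
have S1' y : y != 0 -> `|dil S y| = 1.
  by move=> y0; apply: S1; rewrite -[X in _ != X](mulr0 U^-1) (inj_eq (mulrI _)) ?unitrV.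
have Sb' d : autocorr (dil S) d + 4 * autocorr (dil b) d = c + n *+ (d == 0).
  rewrite !acE Sb; congr (_ + _ *+ _).
  by rewrite -[X in _ == X](mulr0 U^-1) (inj_eq (mulrI _)) ?unitrV.
have := linear_bound v_gt1 v_odd SN' S1' Sb' n_le szW vb.
pose f (y : 'Z_v) := odd_ext v W y.
have fN y : f (- y) = - f y by exact: odd_extN.
have f0 : f 0 = 0 by [].
have E (T F : 'Z_v -> Z) : (forall y, T (- y) = - T y) -> (forall y, F (- y) = - F y) ->
    \sum_y T y * F y = (\sum_(0 <= j < v./2) T j.+1%:R * F j.+1%:R) *+ 2.
  move=> TN FN; rewrite (sum_odd_half v_gt1 v_odd) // big_add1 /= -sumrMnl.
  by apply: eq_bigr => j _; rewrite FN opprK -mulr2n mulrnAr.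
suff -> : \sum_(0 <= j < v./2) dil S j.+1%:R * nth Z0 W j =
  \sum_(0 <= j < v./2) S j.+1%:R * nth Z0 (dilated_row v W u) j by [].
(* A dilation does not preserve the half range, so both half sums are doubled and compared as sums
   over all residues. *)
apply: (@pmulrnI Z 2) => //=.
transitivity (\sum_y dil S y * f y).
  rewrite E //; congr (_ *+ _); apply: eq_big_nat => j /andP[_ jv].
  by rewrite /f odd_ext_small.
rewrite (reindex_inj Ui) /=; under eq_bigr => y _ do rewrite /dil mulKr //.
rewrite (E S (fun y => f (U * y))) //; last by move=> y; rewrite mulrN fN.
congr (_ *+ _); apply: eq_big_nat => j /andP[_ jv].
rewrite /dilated_row (nth_map 0%N) ?size_iota // nth_iota // add1n.
by rewrite /f -natrM val_natr_Zv.
Qed.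

End DilatedBound.

Lemma signed_sum_sign_bits v (A : {set 'Z_v}) (V : seq Z) : (1 < v)%N -> odd v ->
  skew_set A -> size V = v./2 ->
  signed_sum (sign_bits A) V =
  \sum_(0 <= j < v./2) skew_sign Z A j.+1%:R * nth Z0 V j.
Proof.
move=> v1 vo skA szV; rewrite /signed_sum /sign_bits.
have H a m s : (a + m <= v./2)%N -> size s = m ->
   foldr (fun p x => Z.add (if p.1 then p.2 else Z.opp p.2) x) Z0
     (zip [seq j%:R \in A | j <- iota a.+1 m] s) =
   \sum_(0 <= j < m) skew_sign Z A (a + j).+1%:R * nth Z0 s j.
  elim: m a s => [|m IH] a [|z s] //= am; first by rewrite big_nil.
  move=> [sz]; rewrite big_nat_recl //= IH //; last by lia.
  rewrite addn0; congr (_ + _); last by apply: eq_bigr => j _; rewrite addSnnS.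
  rewrite skew_signE // (negbTE (nonzero_small _ _)); try lia.
  by rewrite /indic; case: (_ \in A) => /=; rewrite /GRing.zero /=; lia.
exact: (H 0%N).
Qed.

(* A character of order [e] only depends on the dilation modulo [e], up to sign. *)
Definition unit_reps (v e : nat) : seq nat :=
  foldr (fun u acc => if has (fun t => (t %% e == u %% e) || ((t + u) %% e == 0))%N acc
                      then acc else u :: acc)
        [::] [seq u <- iota 1 v | coprime v u].

(** For [K > 0], the smallest limit for which the last inequality of [valid_bound] can hold. *)
Definition character_limit (v : nat) (N K : Z) (g h W : seq Z) : nat :=
  Z.to_nat (Z.div (Z.add (Z.sqrt (Z.mul N (Z.mul (energy v g) (energy v h))))
                         (rounding_error v K g h W)) K).

(** Nothing is assumed about the numerical data: [valid_bound] is checked by computation, and a pair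
    failing it imposes no constraint. *)
Definition character_roots (v : nat) (N : Z) (gh : Z * seq Z * seq Z) : seq node :=
  let: (K, g, h) := gh in
  let W := weights v K g h in
  let lim := character_limit v N K g h W in
  if valid_bound v N K g h W lim
  then [seq root lim (dilated_row v W u) | u <- unit_reps v (size g)] else [::].

Lemma unit_repsP v e u : u \in unit_reps v e -> coprime v u.
Proof.
rewrite /unit_reps => H.
have : u \in [seq u <- iota 1 v | coprime v u].
  elim: [seq _ <- _ | _] H => //= t s IH; case: ifP => _; rewrite ?inE.
    by move=> /IH ->; rewrite orbT.
  by case/orP => [->|/IH ->] //; rewrite orbT.
by rewrite mem_filter => /andP[].
Qed.

Lemma In_map (T : eqType) (T' : Type) (f : T -> T') s y :
  List.In y (map f s) -> exists2 x, x \in s & y = f x.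
Proof.
elim: s => //= x s IH [<-|/IH[z zs ->]]; first by exists x; rewrite ?mem_head.
by exists z; rewrite // inE zs orbT.
Qed.

Lemma signed_sum_bound v (N : Z) r k l (A B : {set 'Z_v}) K g h lim u :
  let W := weights v K g h in
  (1 < v)%N -> odd v -> is_sds r k l A B -> skew_set A ->
  (r%:R *+ 4 + k%:R *+ 4 - l%:R *+ 4 - 1 <= N) ->
  valid_bound v N K g h W lim -> u \in unit_reps v (size g) ->
  `|signed_sum (sign_bits A) (dilated_row v W u)| <= Z.of_nat lim.
Proof.
move=> W v1 vo sds skA nN vb uin.
have szW : size W = v./2 by rewrite size_map size_iota.
rewrite signed_sum_sign_bits //; last by rewrite size_map size_iota.
apply: (dilated_bound v1 vo _ _ (sds_autocorr Z v1 sds skA) nN szW _ vb).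
- exact: skew_signN.
- move=> y y0; rewrite skew_signE // (negbTE y0) /indic addr0.
  by case: (y \in A).
- exact: unit_repsP uin.
Qed.

Lemma follow_character_roots v (N : Z) r k l (A B : {set 'Z_v}) gh nd :
  (1 < v)%N -> odd v -> is_sds r k l A B -> skew_set A ->
  (r%:R *+ 4 + k%:R *+ 4 - l%:R *+ 4 - 1 <= N) ->
  List.In nd (character_roots v N gh) -> follow nd (sign_bits A) = Leaf.
Proof.
move=> v1 vo sds skA nN; case: gh => -[K g] h; rewrite /character_roots.
case: ifP => // vb H; have [u uin ->] := In_map H.
apply: follow_root; first by rewrite !size_map !size_iota.
exact: (signed_sum_bound v1 vo sds skA nN vb uin).
Qed.

Definition skew_roots (v : nat) (N : Z) (data : seq (Z * seq Z * seq Z)) : seq node :=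
  flatten [seq character_roots v N gh | gh <- data].

Lemma In_flatten_map (T T' : Type) (f : T -> seq T') s y :
  List.In y (flatten (map f s)) -> exists x, List.In y (f x).
Proof.
elim: s => //= x s IH H; case: (List.in_app_or _ _ _ H) => [yx|/IH //].
by exists x.
Qed.

Definition within_bounds (v : nat) (N : Z) (gh : Z * seq Z * seq Z) : seq bool -> bool :=
  let: (K, g, h) := gh in
  let W := weights v K g h in
  let lim := character_limit v N K g h W in
  if valid_bound v N K g h W lim then
    let rows := [seq dilated_row v W u | u <- unit_reps v (size g)] in
    fun bits => all (fun V => Z.leb (Z.abs (signed_sum bits V)) (Z.of_nat lim)) rows
  else xpredT.

Lemma within_boundsP v (N : Z) r k l (A B : {set 'Z_v}) gh :
  (1 < v)%N -> odd v -> is_sds r k l A B -> skew_set A ->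
  (r%:R *+ 4 + k%:R *+ 4 - l%:R *+ 4 - 1 <= N) ->
  within_bounds v N gh (sign_bits A).
Proof.
move=> v1 vo sds skA nN; case: gh => -[K g] h; rewrite /within_bounds.
case: ifP => // vb; apply/allP => _ /mapP[u uin ->].
exact: (signed_sum_bound v1 vo sds skA nN vb uin).
Qed.

(** * From accepted sign strings to dilates of the listed sets *)

Definition dilated_bits (v : nat) (T : seq nat) (d : nat) : seq bool :=
  let t := [seq x \in T | x <- iota 0 v] in
  [seq nth false t ((d * j) %% v) | j <- iota 1 v./2].

Definition bits_table (v : nat) (targets : seq (seq nat)) : seq (seq bool) :=
  [seq dilated_bits v T d | T <- targets, d <- [seq d <- iota 1 v.-1 | coprime v d]].

Definition accept_bits (v : nat) (N : Z) (fine : Z * seq Z * seq Z)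
    (targets : seq (seq nat)) : seq bool -> bool :=
  let tab := bits_table v targets in
  let ok := within_bounds v N fine in
  fun bits => if ok bits then bits \in tab else true.

Definition is_skew_seq (v : nat) (T : seq nat) : bool :=
  (0%N \notin T) && all (fun x => ((v - x)%N \in T) == (x \notin T)) (iota 1 v.-1).

(* Multiplying by [-1] we may assume [1 \in A], so the first sign is fixed.  The
  search uses the coarse weights of [data]; survivors failing the sharper
  inequality given by [fine] are discarded. *)
Definition skew_search (v : nat) (N : Z) (data : seq (Z * seq Z * seq Z))
    (fine : Z * seq Z * seq Z) (targets : seq (seq nat)) : bool :=
  if all (is_skew_seq v) targets && all (all (fun x => x < v)%N) targets then
  search (accept_bits v N fine targets) v./2.-1
    (map pos_child (skew_roots v N data)) [:: true]
  else false.

Lemma in_residues v T (x : 'Z_v) : (1 < v)%N -> all (fun x => x < v)%N T ->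
  (x \in residues v T) = (nat_of_ord x \in T).
Proof.
move=> v1 /allP Tv; rewrite inE; apply/mapP/idP => [[n nT ->]|xT].
  by rewrite val_natr_Zv // modn_small ?Tv.
by exists (nat_of_ord x) => //; rewrite natr_Zp.
Qed.

Lemma skew_residues v T : (1 < v)%N -> all (fun x => x < v)%N T -> is_skew_seq v T ->
  skew_set (residues v T).
Proof.
move=> v1 Tv /andP[T0 /allP Tn]; split; first by rewrite in_residues.
move=> x x0; rewrite !in_residues //; have xv : (x < v)%N by rewrite -[X in (_ < X)%N]Zp_cast.
have x1 : (0 < x)%N by rewrite lt0n -(inj_eq val_inj) in x0 *.
have -> : nat_of_ord (- (x : 'Z_v))%R = (v - x)%N.
  rewrite -{1}[x]natr_Zp -natrN_Zv ?(ltnW xv) // val_natr_Zv // modn_small //; lia.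
by apply/eqP/Tn; rewrite mem_iota; lia.
Qed.

Lemma skew_searchP v N data fine targets r k l (A B : {set 'Z_v}) :
  skew_search v N data fine targets -> (2 < v)%N -> odd v ->
  is_sds r k l A B -> skew_set A -> 1 \in A ->
  (r%:R *+ 4 + k%:R *+ 4 - l%:R *+ 4 - 1 <= N) ->
  exists2 T, T \in targets &
    exists d, [/\ (0 < d < v)%N, coprime d v & dilate d A = residues v T].
Proof.
rewrite /skew_search; case: ifP => // /andP[/allP skT /allP ltT].
move=> H v2 vo sds skA A1 nN; have v1 : (1 < v)%N by exact: ltnW.
(* This is why the search starts from the positive children of the roots, with the path
   [[:: true]]. *)
have E : sign_bits A = true :: behead (sign_bits A).
  rewrite /sign_bits; have -> : v./2 = v./2.-1.+1 by lia.
  by rewrite /= A1.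
have : accept_bits v N fine targets (sign_bits A).
  rewrite E; apply: (search_sound (bits := behead (sign_bits A)) H).
    by rewrite size_behead size_map size_iota.
  move=> n Hn; have /List.in_map_iff[n' [<- Hn']] := Hn; have [gh Hgh] := In_flatten_map Hn'.
  by have := follow_character_roots v1 vo sds skA nN Hgh; rewrite E.
rewrite /accept_bits (within_boundsP _ v1 vo sds skA nN).
case/allpairsP => -[T d] /= [TT]; rewrite mem_filter mem_iota => /andP[cd dv] Eb.
exists T => //; exists d; split; [lia|by rewrite coprime_sym|].
have skR : skew_set (residues v T) by apply: skew_residues; rewrite ?ltT ?skT.
have Hj j : (0 < j < v./2.+1)%N -> (j%:R \in A) = (d%:R * j%:R \in residues v T).
  move=> jv; have := congr1 (fun s => nth false s j.-1) Eb.
  rewrite /sign_bits !(nth_map 0%N) ?size_iota ?nth_iota; try lia.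
  have -> : (1 + j.-1 = j)%N by lia.
  by move=> ->; rewrite in_residues ?ltT // -natrM val_natr_Zv // add0n modn_mod.
have Ud : (d%:R : 'Z_v) \is a GRing.unit by rewrite unitZpE.
(* Agreement on [1, ..., v./2] extends to all residues since both sets are skew. *)
have Hx (x : 'Z_v) : (x \in A) = (d%:R * x \in residues v T).
  case: (eqVneq x 0) => [->|x0].
    by rewrite mulr0 (negbTE skA.1) (negbTE skR.1).
  have xv : (x < v)%N by rewrite -[X in (_ < X)%N]Zp_cast.
  have x1 : (0 < x)%N by rewrite lt0n -(inj_eq val_inj) in x0 *.
  case: (ltnP x v./2.+1) => xm; first by rewrite -[x]natr_Zp Hj ?x1.
  have := Hj (v - x)%N; rewrite natrN_Zv ?(ltnW xv) // natr_Zp => Hn.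
  have dx0 : d%:R * x != 0 by rewrite -[X in _ != X](mulr0 d%:R) (inj_eq (mulrI Ud)).
  rewrite -[LHS]negbK -(skA.2 x x0) Hn; last first.
    by clear -vo v2 x1 xv xm; move: x1 xv xm; move: (nat_of_ord x) => n; lia.
  by rewrite mulrN (skR.2 _ dx0) negbK.
apply/setP => y; apply/imsetP/idP => [[x xA ->]|yT]; first by rewrite -Hx.
by exists (d%:R^-1 * y); rewrite ?mulVKr // Hx mulVKr.
Qed.

(** * Enumeration of the complementary block *)

Definition cyc_dist (v x y : nat) : nat :=
  let d := ((x - y) + (y - x))%N in minn d (v - d).

Fixpoint pair_count (v i : nat) (s : seq nat) : nat :=
  if s is x :: s' then (count_mem i [seq cyc_dist v x y | y <- s'] + pair_count v i s')%N
  else 0%N.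

Lemma corrN (G : finZmodType) (B : {set G}) d : corr B (- d) = corr B d.
Proof.
rewrite /corr -(card_imset [set x in B | x + d \in B] (addIr d)).
apply: eq_card => x; apply/idP/imsetP => [|[y]]; rewrite !inE => /andP[a b].
  by exists (x - d); rewrite ?inE ?subrK ?b.
by move=> ->; rewrite addrK b.
Qed.

Lemma corrS (G : finZmodType) (A B : {set G}) d : A \subset B -> (corr A d <= corr B d)%N.
Proof.
move=> /subsetP AB; apply: subset_leq_card; apply/subsetP => x.
by rewrite !inE => /andP[/AB -> /AB ->].
Qed.

(** The new pairs of difference [d] are [(x, x + d)] and [(x - d, x)]; the pair [(x, x)] would need
    [d = 0]. *)
Lemma corrU1 (G : finZmodType) (A : {set G}) x d : x \notin A -> d != 0 ->
  corr (x |: A) d = (((x + d)%R \in A) + ((x - d)%R \in A) + corr A d)%N.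
Proof.
move=> xA d0; apply/eqP; rewrite -(eqr_nat Z) !natrD -!autocorr_indic; apply/eqP.
have iU y : indic Z (x |: A) y = indic Z A y + (y + - x == 0)%:R.
  rewrite /indic in_setU1 subr_eq0; case: (eqVneq y x) => [->|_] /=.
    by rewrite (negbTE xA) add0r.
  by rewrite addr0.
rewrite {1}/autocorr; under eq_bigr => y _ do rewrite !iU mulrDl !mulrDr.
rewrite !big_split /= -/(autocorr _ _).
under [X in _ + X + _]eq_bigr => y _ do rewrite -addrA.
rewrite sum_delta opprB.
under [X in _ + (X + _)]eq_bigr => y _ do rewrite mulrC.
rewrite sum_delta opprK.
rewrite [X in _ + (_ + X)]big1 ?addr0; first by rewrite /indic; ring.
move=> y _; case: (eqVneq y x) => [->|yx].
  by rewrite [_ + d]addrC addrK (negbTE d0) mulr0.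
by rewrite subr_eq0 (negbTE yx) mul0r.
Qed.

Lemma natr_modv v n : (1 < v)%N -> ((n %% v)%N%:R : 'Z_v) = n%:R.
Proof. by move=> v1; apply: val_inj; rewrite /= !val_natr_Zv // modn_mod. Qed.

Section PairCount.
Variable v : nat.
Hypotheses (v_gt1 : (1 < v)%N) (v_odd : odd v).
Implicit Types (s : seq nat) (B : {set 'Z_v}).

Lemma natr_Zv_inj x y : (x < v)%N -> (y < v)%N -> (x%:R : 'Z_v) = y%:R -> x = y.
Proof.
move=> xv yv /(congr1 (@nat_of_ord _)).
by rewrite !val_natr_Zv // !modn_small.
Qed.

Lemma residues_natr s x : all (fun x => x < v)%N s -> (x < v)%N ->
  (x%:R \in residues v s) = (x \in s).
Proof. by move=> sv xv; rewrite in_residues // val_natr_Zv // modn_small. Qed.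

(** As [v] is odd, an unordered pair at cyclic distance [i] is ordered in exactly one way with
    difference [i]. A new element [x] meets its two neighbours [a = x + i] and [b = x - i] modulo
    [v]. *)
Lemma pair_count_corr s i : uniq s -> all (fun x => x < v)%N s -> (0 < i <= v./2)%N ->
  pair_count v i s = corr (residues v s) i%:R.
Proof.
move=> + + iv; elim: s => [_ _|x s IH] /=.
  by rewrite /corr (eq_card0 (A := [set _ in _ | _])) // => x; rewrite !inE.
move=> /andP[xs us] /andP[xv sv]; rewrite IH //.
have -> : residues v (x :: s) = x%:R |: residues v s.
  by apply/setP => y; rewrite in_setU1 /residues !in_set /= in_cons.
have i0 : i%:R != 0 :> 'Z_v by apply: nonzero_small => //; lia.
rewrite corrU1 ?residues_natr //; congr (_ + _)%N.
pose a := ((x + i) %% v)%N; pose b := ((x + (v - i)) %% v)%N.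
have av : (a < v)%N by rewrite ltn_mod; lia.
have bv : (b < v)%N by rewrite ltn_mod; lia.
have aE : a = (x + i)%N \/ (a = x + i - v /\ v <= x + i)%N.
  rewrite /a; case: (ltnP (x + i)%N v) => h; first by left; rewrite modn_small.
  by right; split=> //; rewrite -[in LHS](subnK h) modnDr modn_small //; lia.
have bE : (b = x + (v - i) /\ x < i)%N \/ (b = x - i /\ i <= x)%N.
  rewrite /b; case: (ltnP x i) => h; first by left; split=> //; rewrite modn_small //; lia.
  have -> : (x + (v - i) = x - i + v)%N by lia.
  by right; split=> //; rewrite modnDr modn_small //; lia.
have -> : x%:R + i%:R \in residues v s = (a \in s).
  by rewrite -natrD -(natr_modv _ v_gt1) residues_natr.
have -> : x%:R - i%:R \in residues v s = (b \in s).
  by rewrite -natrN_Zv; [rewrite -natrD -(natr_modv _ v_gt1) residues_natr|lia|lia].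
rewrite -!(count_uniq_mem _ us) count_map -count_predUI.
clearbody a b; clear IH.
(* The neighbours are distinct: [a = b] would make [2 i] a multiple of the odd number [v]. *)
rewrite [X in (_ + X)%N](_ : _ = 0%N) ?addn0; last first.
  apply/eqP; rewrite -leqn0 leqNgt -has_count; apply/hasPn => y _ /=.
  by apply/negP => /andP[/eqP-> /eqP]; lia.
apply: eq_in_count => y ys /=; have yv := allP sv y ys.
have yx : y != x by apply: contraNneq xs => <-.
rewrite /cyc_dist; clear -av bv aE bE iv yv yx v_gt1 v_odd xv.
by apply/eqP/orP => [di|[] /eqP]; lia.
Qed.

Lemma pair_count_out s i : uniq s -> all (fun x => x < v)%N s -> ~~ (0 < i <= v./2)%N ->
  pair_count v i s = 0%N.
Proof.
move=> + + iv; elim: s => //= x s IH /andP[xs us] /andP[xv sv]; rewrite IH // addn0.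
apply/eqP; rewrite -leqn0 leqNgt -has_count; apply/hasPn => _ /mapP[y ys ->] /=.
have yv := allP sv y ys; have yx : y != x by apply: contraNneq xs => <-.
by apply: contra iv => /eqP <-; rewrite /cyc_dist; lia.
Qed.

End PairCount.

(** * Backtracking for [B] under budgets for its differences *)

Fixpoint decr (d : nat) (Q : seq nat) : option (seq nat) :=
  if Q is q :: Q' then
    if d is d'.+1 then if decr d' Q' is Some R then Some (q :: R) else None
    else if q is q'.+1 then Some (q' :: Q') else None
  else None.

Fixpoint decrs (ds Q : seq nat) : option (seq nat) :=
  if ds is d :: ds' then if decr d Q is Some Q' then decrs ds' Q' else None else Some Q.

Lemma decrP d Q : (0 < nth 0 Q d)%N ->
  exists2 Q', decr d Q = Some Q' & forall i, (nth 0 Q' i + (d == i) = nth 0 Q i)%N.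
Proof.
elim: Q d => [|q Q IH] [|d] //=.
  case: q => // q _; exists (q :: Q) => // -[|i] /=; lia.
by move=> /IH[Q' -> H]; exists (q :: Q') => // -[|i] /=; rewrite ?addn0 //; apply: H.
Qed.

Lemma decrsP (ds Q : seq nat) : (forall i : nat, count_mem i ds <= nth 0 Q i)%N ->
  exists2 Q', decrs ds Q = Some Q' &
    forall i, (nth 0 Q' i + count_mem i ds = nth 0 Q i)%N.
Proof.
elim: ds Q => [|d ds IH] Q /= H; first by exists Q => // i; rewrite addn0.
have [|Q1 -> H1] := @decrP d Q; first by have := H d; rewrite eqxx; lia.
have [|Q2 -> H2] := IH Q1.
  by move=> i; have := H i; have := H1 i; move: (count_mem i ds) => c; lia.
by exists Q2 => // i; have := H1 i; have := H2 i; move: (count_mem i ds) => c; lia.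
Qed.

Section Extend.
Variables (v : nat) (accept : seq nat -> bool).

Definition add_elt (x : nat) (cur Q : seq nat) : option (seq nat) :=
  decrs [seq cyc_dist v x y | y <- cur] Q.

(** A candidate is either taken or dropped for good. The value [true] means that every completion is
    accepted; it is returned at once when too few candidates remain. *)
Fixpoint extend (left : nat) (cur Q cand : seq nat) : bool :=
  if left is l.+1 then
    (fix try_all (cand : seq nat) : bool :=
       if cand is x :: rest then
         if (size rest < l)%N then true
         else if (if add_elt x cur Q is Some Q' then
                    extend l (x :: cur) Q'
                      [seq c <- rest | if add_elt c (x :: cur) Q' is Some _ then true else false]
                  else true)
         then try_all rest else false
       else true) cand
  else accept cur.

Fixpoint add_elts (xs cur Q : seq nat) : option (seq nat) :=
  if xs is x :: xs' then
    if add_elt x cur Q is Some Q' then add_elts xs' (x :: cur) Q' else None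
  else Some Q.

Variables (B : {set 'Z_v}) (P : seq nat).
Hypotheses (v_gt1 : (1 < v)%N) (v_odd : odd v).
Hypothesis PB : forall i, (0 < i <= v./2)%N -> nth 0%N P i = corr B i%:R.

Definition in_set s := all (fun x => (x < v)%N && (x%:R \in B)) s.

Lemma pair_count_le s i : uniq s -> in_set s -> (pair_count v i s <= nth 0%N P i)%N.
Proof.
move=> us sB; have sv : all (fun x => x < v)%N s by apply: sub_all sB => x /andP[].
case: (boolP (0 < i <= v./2)%N) => iv; last by rewrite pair_count_out.
rewrite pair_count_corr // PB //; apply: corrS; apply/subsetP => x.
by rewrite in_residues // => /(allP sB)/andP[_]; rewrite natr_Zp.
Qed.

Definition balanced cur Q := forall i, (nth 0 Q i + pair_count v i cur = nth 0 P i)%N.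

(** A part of [B] has no more differences of any kind than [B], so elements of [B] never exhaust a
    budget. *)
Lemma add_eltP x cur Q : uniq (x :: cur) -> in_set (x :: cur) -> balanced cur Q ->
  exists2 Q', add_elt x cur Q = Some Q' & balanced (x :: cur) Q'.
Proof.
move=> u iB bal; have [i|Q' E H] := @decrsP [seq cyc_dist v x y | y <- cur] Q.
  by have := @pair_count_le (x :: cur) i u iB; have := bal i; rewrite /=; lia.
by exists Q' => // i; have := H i; have := bal i; rewrite /=; lia.
Qed.

(** The branch that takes exactly the elements of [B] survives all pruning: [B] stays inside
    [cur ++ cand], and it ends with a list of [B] that was accepted. *)
Lemma extendP left cur Q cand : extend left cur Q cand ->
  uniq (cur ++ cand) -> in_set cur -> balanced cur Q ->
  (forall x, (x < v)%N -> x%:R \in B -> x \in cur ++ cand) ->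
  (left + size cur = #|B|)%N ->
  exists s, [/\ accept s, uniq s, in_set s & size s = #|B|].
Proof.
elim: left cur Q cand => [|l IH] cur Q cand /=.
  move=> acc; rewrite cat_uniq => /and3P[uc _ _] iB bal _ szB.
  by exists cur; split=> //; rewrite -szB.
elim: cand => [|x rest IHc].
  move=> _; rewrite cats0 => uc iB _ BC szB; exfalso.
  suff : (#|B| <= size cur)%N by rewrite -szB; lia.
  rewrite cardE -(size_map (@nat_of_ord _)); apply: uniq_leq_size.
    by rewrite (map_inj_uniq val_inj) enum_uniq.
  move=> _ /mapP[y + ->]; rewrite mem_enum => yB; apply: BC; last by rewrite natr_Zp.
  by rewrite -[X in (_ < X)%N]Zp_cast.
case: ltnP => [szr|_].
  move=> _ uc iB _ BC szB; exfalso.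
  suff : (#|B| <= size (cur ++ x :: rest))%N by rewrite -szB size_cat /=; lia.
  rewrite cardE -(size_map (@nat_of_ord _)); apply: uniq_leq_size.
    by rewrite (map_inj_uniq val_inj) enum_uniq.
  move=> _ /mapP[y + ->]; rewrite mem_enum => yB; apply: BC; last by rewrite natr_Zp.
  by rewrite -[X in (_ < X)%N]Zp_cast.
case: ifP => // Hx Hrest uc iB bal BC szB.
have xv_or : ((x < v)%N && (x%:R \in B)) || ~~ ((x < v)%N && (x%:R \in B)) by case: (_ && _).
case/orP: xv_or => [xB|xnB]; last first.
  apply: IHc Hrest _ iB bal _ szB.
    by move: uc; rewrite !cat_uniq /= negb_or => /and3P[-> /andP[_ ->] /andP[_ ->]].
  move=> y yv yB; have := BC y yv yB; rewrite !mem_cat inE.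
  by case: (eqVneq y x) yv yB xnB => [-> -> ->|].
have xc : x \notin cur.
  by move: uc; rewrite cat_uniq /= negb_or => /and3P[_ /andP[xc _] _].
have ucur : uniq cur by move: uc; rewrite cat_uniq => /and3P[].
have urest : uniq rest by move: uc; rewrite cat_uniq /= => /and4P[].
have rest_new y : y \in rest -> y \notin x :: cur.
  move: uc; rewrite cat_uniq /= negb_or => /and3P[_ /andP[_ /hasPn H] /andP[xr _]] yr.
  by rewrite inE negb_or (H y yr) andbT; apply: contraNneq xr => <-.
have u1 : uniq (x :: cur) by rewrite /= xc.
have i1 : in_set (x :: cur) by rewrite /= xB.
have [Q' E bal'] := add_eltP u1 i1 bal.
move: Hx; rewrite E => Hx; apply: (IH _ _ _ Hx) => //; last 1 first.
- by rewrite /= addnS -szB.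
- rewrite cat_uniq u1 filter_uniq // andbT.
  by apply/hasPn => y; rewrite mem_filter => /andP[_ /rest_new].
move=> y yv yB; rewrite mem_cat.
case: (boolP (y \in x :: cur)) => //= yc; rewrite mem_filter.
have yr : y \in rest.
  have := BC y yv yB; rewrite mem_cat; move: yc.
  by rewrite !inE negb_or => /andP[/negbTE-> /negbTE->].
rewrite yr andbT.
have uy : uniq (y :: x :: cur) by rewrite cons_uniq yc u1.
have iy : in_set (y :: x :: cur) by apply/andP; split=> //; apply/andP.
by have [Q2 -> _] := add_eltP uy iy bal'.
Qed.

Lemma add_eltsP xs cur Q : uniq (rev xs ++ cur) -> in_set (rev xs ++ cur) -> balanced cur Q ->
  exists2 Q', add_elts xs cur Q = Some Q' & balanced (rev xs ++ cur) Q'.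
Proof.
elim: xs cur Q => [|x xs IH] cur Q /=; first by exists Q.
rewrite rev_cons cat_rcons => u iB bal.
have u1 : uniq (x :: cur) by move: u; rewrite cat_uniq => /and3P[].
have i1 : in_set (x :: cur) by move: iB; rewrite /in_set all_cat => /andP[].
have [Q1 E bal1] := add_eltP u1 i1 bal.
by rewrite E; have [Q2 -> bal2] := IH _ _ u iB bal1; exists Q2.
Qed.

End Extend.

(** * The search for [B] up to translation *)

Definition seq_corr (v : nat) (T : seq nat) (d : nat) : nat :=
  count (fun x => (x + d) %% v \in T)%N T.

Lemma card_residues v T : (1 < v)%N -> uniq T -> all (fun x => x < v)%N T ->
  #|residues v T| = size T.
Proof.
move=> v1 uT Tv; rewrite cardsE -(size_map (fun n => n%:R : 'Z_v)); apply/card_uniqP.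
rewrite map_inj_in_uniq // => x y /(allP Tv) xv /(allP Tv) yv.
exact: natr_Zv_inj.
Qed.

Lemma seq_corrE v T d : (1 < v)%N -> uniq T -> all (fun x => x < v)%N T ->
  corr (residues v T) (d%:R : 'Z_v) = seq_corr v T d.
Proof.
move=> v1 uT Tv; rewrite /seq_corr -size_filter -[RHS](card_residues v1).
- apply: eq_card => x; rewrite inE !in_residues //.
    by rewrite mem_filter andbC val_addr_Zv // val_natr_Zv // modnDmr.
  by apply/allP => y; rewrite mem_filter => /andP[_ /(allP Tv)].
- exact: filter_uniq.
- by apply/allP => y; rewrite mem_filter => /andP[_ /(allP Tv)].
Qed.

Fixpoint subseqs (T : Type) (n : nat) (s : seq T) : seq (seq T) :=
  if s is x :: s' then
    (if n is n'.+1 then map (cons x) (subseqs n' s') else [::]) ++ subseqs n s'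
  else if n is 0%N then [:: [::]] else [::].

Lemma mem_subseqs (T : eqType) (t s : seq T) : subseq t s -> t \in subseqs (size t) s.
Proof.
elim: s t => [|x s IH] t; first by rewrite subseq0 => /eqP ->.
case: t => [|y t] /=; first by move=> _; rewrite -[0%N]/(size (@nil T)) IH ?sub0seq.
rewrite mem_cat; case: eqP => [-> st|_ st].
  by apply/orP; left; apply: map_f; exact: IH.
by apply/orP; right; exact: (IH (y :: t)).
Qed.

(* A set of residues has a translate with least sum of representatives; only such
  translates containing [0] need be considered as starting points. *)
Definition canonical (v : nat) (X : seq nat) : bool :=
  all (fun y => sumn X <= sumn [seq (x + (v - y)) %% v | x <- X])%N X.

Definition starts (v p : nat) : seq (seq nat) :=
  [seq X <- [seq 0%N :: X | X <- subseqs p.-1 (iota 1 v.-1)] | canonical v X].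

(* If [B] has [p] differences equal to [e] then, up to translation, it contains
  [X] and [X + e] for some starting set [X] of size [p]. *)
Definition run_start (v k e : nat) (P : seq nat) (accept : seq nat -> bool)
    (X : seq nat) : bool :=
  let st := undup (X ++ [seq (x + e) %% v | x <- X])%N in
  if (k < size st)%N then true else
  if add_elts v st [::] P is Some Q then
    extend v accept (k - size st) (rev st) Q
      [seq c <- iota 0 v |
         if c \in st then false else if add_elt v c (rev st) Q is Some _ then true else false]
  else true.

(** Entry [d] belongs to the difference [d]. The search first tests that no count at [1, ..., v./2]
    exceeds [l], so the subtraction is exact there. *)
Definition budgets (v l : nat) (T : seq nat) : seq nat :=
  [seq (l - seq_corr v T d)%N | d <- iota 0 v./2.+1].

(** The value is [true] outright when the budgets admit no [B]. Blocks of size 0 and 1 are unique up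
    to translation. *)
Definition complement_search (v k l e : nat) (T : seq nat) (accept : seq nat -> bool) : bool :=
  if has (fun d => l < seq_corr v T d)%N (iota 1 v./2) then true else
  let P := budgets v l T in
  if k is 0%N then
    if all (pred1 0%N) (behead P) then accept [::] else true
  else if k is 1%N then accept [:: 0%N]
  else if (0 < e <= v./2)%N && (0 < nth 0%N P e)%N
  then all (run_start v k e P accept) (starts v (nth 0%N P e)) else false.

Definition translate v (a : 'Z_v) (B : {set 'Z_v}) : {set 'Z_v} := signed_shift false a B.

Lemma in_translate v (a y : 'Z_v) B : (y \in translate a B) = (y - a \in B).
Proof.
apply/imsetP/idP => [[x xB ->]|yB]; first by rewrite expr0 mul1r addrK.
by exists (y - a) => //; rewrite expr0 mul1r subrK.
Qed.

Lemma card_translate v (a : 'Z_v) B : #|translate a B| = #|B|.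
Proof. by apply: card_imset => x y /addIr; rewrite expr0 !mul1r. Qed.

Lemma corr_translate v (a : 'Z_v) B d : corr (translate a B) d = corr B d.
Proof.
rewrite /corr -(card_imset [set x in B | x + d \in B] (addIr a)); apply: eq_card => x.
apply/idP/imsetP => [|[y]]; rewrite !inE.
  rewrite !in_translate => /andP[xB xdB]; exists (x - a); last by rewrite subrK.
  by rewrite inE xB addrAC.
by move=> /andP[yB ydB] ->; rewrite !in_translate addrK yB addrAC addrK ydB.
Qed.

Section ComplementSearch.
Variables (v k l e : nat) (T : seq nat) (accept : seq nat -> bool).
Hypotheses (v_gt1 : (1 < v)%N) (v_odd : odd v).

Lemma in_set_leq_card (B : {set 'Z_v}) s : uniq s -> in_set B s -> (size s <= #|B|)%N.
Proof.
move=> us sB; have sv : all (fun x => x < v)%N s by apply: sub_all sB => x /andP[].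
rewrite -(card_residues v_gt1 us sv); apply: subset_leq_card; apply/subsetP => x.
by rewrite in_residues // => /(allP sB)/andP[_]; rewrite natr_Zp.
Qed.

Lemma in_set_residues (B : {set 'Z_v}) s : uniq s -> in_set B s -> size s = #|B| ->
  residues v s = B.
Proof.
move=> us sB szs; have sv : all (fun x => x < v)%N s by apply: sub_all sB => x /andP[].
apply/eqP; rewrite eqEcard (card_residues v_gt1 us sv) szs leqnn andbT.
apply/subsetP => x; rewrite in_residues // => /(allP sB)/andP[_]; by rewrite natr_Zp.
Qed.

Lemma sumn_enum (X : {set 'Z_v}) (f : nat -> nat) :
  sumn [seq f (nat_of_ord x) | x <- enum X] = (\sum_(x in X) f (nat_of_ord x))%N.
Proof. by rewrite sumnE big_map big_enum. Qed.

(** Translate by [- y], where [y] in [X0] minimises the sum [rank y] of the representatives of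
    [X0 - y]; then 0 belongs to the translate. *)
Lemma canonical_translate (X0 : {set 'Z_v}) : X0 != set0 ->
  exists a s, [/\ (0%N :: s) \in starts v #|X0|, uniq (0%N :: s) &
                in_set (translate a X0) (0%N :: s)].
Proof.
case/set0Pn => y0 y0X.
pose rank (y : 'Z_v) := (\sum_(x in X0) nat_of_ord (x - y)%R)%N.
have [y yX ymin] := arg_minnP rank y0X.
pose X := translate (- y) X0.
pose L := [seq x <- iota 0 v | (x%:R : 'Z_v) \in X].
have uL : uniq L by rewrite filter_uniq ?iota_uniq.
have inL : in_set X L.
  by apply/allP => x; rewrite mem_filter mem_iota => /andP[-> /andP[_ ->]].
have LX (x : 'Z_v) : (nat_of_ord x \in L) = (x \in X).
  by rewrite mem_filter natr_Zp mem_iota /= -[X in (_ < X)%N]Zp_cast // ltn_ord andbT.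
have X0in : 0 \in X by rewrite in_translate sub0r opprK.
have iv : iota 0 v = 0%N :: iota 1 v.-1 by case: (v) v_gt1.
have [s Ls] : exists s, L = 0%N :: s.
  by rewrite /L iv /= X0in; eexists.
have szL : size L = #|X0|.
  rewrite -(card_translate (- y)) -/X -(in_set_residues uL inL) ?card_residues //.
    by apply: sub_all inL => x /andP[].
  apply/eqP; rewrite eqn_leq in_set_leq_card //= cardE -(size_map (@nat_of_ord _)).
  apply: uniq_leq_size; first by rewrite (map_inj_uniq val_inj) enum_uniq.
  by move=> _ /mapP[x + ->]; rewrite mem_enum LX.
have permL : perm_eq L [seq nat_of_ord x | x <- enum X].
  apply: uniq_perm => //; first by rewrite (map_inj_uniq val_inj) enum_uniq.
  move=> x; apply/idP/mapP => [xL|[z + ->]]; last by rewrite mem_enum LX.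
  have /andP[xv xX] := allP inL x xL; exists x%:R; first by rewrite mem_enum.
  by rewrite val_natr_Zv // modn_small.
have sumL (f : nat -> nat) : sumn (map f L) = (\sum_(x in X0) f (nat_of_ord (x - y)%R))%N.
  rewrite (perm_sumn (perm_map f permL)) -map_comp sumn_enum.
  rewrite (reindex_inj (addIr (- y))) /=; apply: eq_bigl => x.
  by rewrite in_translate opprK subrK.
exists (- y), s; rewrite -Ls; split=> //.
rewrite mem_filter Ls map_f ?andbT; last first.
  rewrite -szL Ls /=; apply: mem_subseqs.
  suff -> : s = [seq x <- iota 1 v.-1 | (x%:R : 'Z_v) \in X] by exact: filter_subseq.
  have := Ls; rewrite /L iv.
  by rewrite /= X0in => -[].
rewrite -Ls; apply/allP => z zL; have /andP[zv zX] := allP inL z zL.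
rewrite -{1}[L]map_id !sumL.
pose z' : 'Z_v := z%:R + y.
have z'X : z' \in X0 by move: zX; rewrite in_translate opprK.
have -> : (\sum_(x in X0) (nat_of_ord (x - y)%R + (v - z)) %% v)%N = rank z'.
  apply: eq_bigr => x _; rewrite /z' opprD addrCA addrC.
  rewrite -natrN_Zv ?(ltnW zv) //.
  by rewrite [RHS]val_addr_Zv // val_natr_Zv // modnDmr.
exact: ymin.
Qed.

End ComplementSearch.

Lemma in_set_lt v (B : {set 'Z_v}) s : in_set B s -> all (fun x => x < v)%N s.
Proof. by apply: sub_all => x /andP[]. Qed.

Lemma complement_searchP v r k l e T accept (B : {set 'Z_v}) :
  (1 < v)%N -> odd v -> complement_search v k l e T accept ->
  uniq T -> all (fun x => x < v)%N T -> is_sds r k l (residues v T) B ->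
  exists a s, [/\ accept s, uniq s, all (fun x => x < v)%N s & residues v s = translate a B].
Proof.
move=> v1 vo + uT Tv [cT cB H]; rewrite /complement_search.
have HB i : (0 < i <= v./2)%N -> (seq_corr v T i + corr B (i%:R : 'Z_v) = l)%N.
  move=> iv; rewrite -seq_corrE // -!diff_countE; apply: H.
  by apply: nonzero_small => //; lia.
case: hasP => [[d]|_].
  by rewrite mem_iota => dv; have := HB d; lia.
set P := budgets v l T.
have PE i : (0 < i <= v./2)%N -> nth 0%N P i = corr B (i%:R : 'Z_v).
  move=> iv; rewrite (nth_map 0%N) ?size_iota ?nth_iota; try lia.
  by have := HB i iv; rewrite add0n; lia.
have residues_in s a : uniq s -> in_set (translate a B) s -> size s = #|B| ->
    accept s -> exists a s, [/\ accept s, uniq s, all (fun x => x < v)%N s &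
      residues v s = translate a B].
  move=> us sB szs acc; exists a, s; split=> //; first exact: in_set_lt sB.
  by apply: in_set_residues; rewrite ?card_translate.
case: k cB => [|[|k]] cB.
- case: allP => [_ acc|P0].
    by apply: (residues_in [::] 0) => //; rewrite cB.
  case: P0 => x; rewrite /P /budgets /= => /mapP[d]; rewrite mem_iota => dv ->.
  have := HB d; rewrite /corr; move/cards0_eq: cB => ->.
  rewrite (eq_card0 (A := [set _ in set0 | _])); last by move=> y; rewrite !inE.
  by move=> hd; apply/eqP; lia.
- move=> acc; move/eqP/cards1P: (cB) => [b Bb].
  apply: (residues_in [:: 0%N] (- b)) => //.
  by rewrite /= andbT ltnW // in_translate opprK add0r Bb set11.
case: ifP => // /andP[ev pe] /allP Hst.
(* The first elements of the pairs of difference [e]: a translate of [B] contains a starting set and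
   its shift by [e]. *)
pose X0 := [set x in B | x + e%:R \in B].
have cX : #|X0| = nth 0%N P e by rewrite PE.
have X0n : X0 != set0 by rewrite -card_gt0 cX.
have [a [s [sst us sX]]] := canonical_translate v1 X0n.
rewrite cX in sst.
move: (Hst _ sst); rewrite /run_start.
set st := undup _; set B' := translate a B.
have iB' : in_set B' st.
  apply/allP => x; rewrite mem_undup mem_cat => /orP[/(allP sX)/andP[-> ]|/mapP[y ys ->]].
    by rewrite !in_translate inE => /andP[-> _].
  have /andP[yv] := allP sX y ys; rewrite !in_translate inE => /andP[yB yeB].
  by rewrite ltn_mod ltnW //= natr_modv // natrD addrAC.
have ust : uniq st by exact: undup_uniq.
have cB' : #|B'| = k.+2 by rewrite card_translate.
have szst : (size st <= k.+2)%N by rewrite -cB'; apply: in_set_leq_card.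
rewrite ltnNge szst /=.
have PE' i : (0 < i <= v./2)%N -> nth 0%N P i = corr B' (i%:R : 'Z_v).
  by move=> iv; rewrite corr_translate PE.
have bal0 : balanced v P [::] P by move=> i; rewrite /= addn0.
have [||Q -> balQ] := add_eltsP v1 vo PE' (xs := st) (cur := [::]) _ _ bal0.
- by rewrite cats0 rev_uniq.
- by rewrite cats0 /in_set all_rev.
rewrite cats0 in balQ.
move=> /(extendP v1 vo PE')[].
- rewrite cat_uniq rev_uniq ust filter_uniq ?iota_uniq // andbT.
  apply/hasPn => c; rewrite mem_filter mem_rev => /andP[+ _].
  by case: ifP.
- by rewrite /in_set all_rev.
- exact: balQ.
- move=> x xv xB; rewrite mem_cat mem_rev mem_filter mem_iota xv andbT.
  case: ifP => //= xst.
  have [||Q' -> _] // := add_eltP v1 vo PE' (x := x) (cur := rev st) _ _ balQ.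
  + by rewrite /= mem_rev xst rev_uniq.
  + by rewrite /in_set /= xv xB all_rev.
- by rewrite size_rev cB' subnK.
move=> s' [acc us' is' szs'].
by apply: (residues_in s' a); rewrite // szs' card_translate.
Qed.

(** * Moves between supplementary difference sets *)

Section Moves.
Variable v : nat.
Hypotheses (v_gt1 : (1 < v)%N) (v_odd : odd v).
Implicit Types (A B : {set 'Z_v}).

Lemma in_dilate d A x : coprime v d -> (d%:R * x \in dilate d A) = (x \in A).
Proof.
move=> cd; have Ud : (d%:R : 'Z_v) \is a GRing.unit by rewrite unitZpE.
by apply/imsetP/idP => [[y yA /(mulrI Ud) ->]|xA] //; exists x.
Qed.

Lemma card_dilate d A : coprime v d -> #|dilate d A| = #|A|.
Proof. by move=> cd; apply: card_imset; apply: mulrI; rewrite unitZpE. Qed.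

Lemma corr_dilate d A i : coprime v d -> corr (dilate d A) (d%:R * i) = corr A i.
Proof.
move=> cd; have Ud : (d%:R : 'Z_v) \is a GRing.unit by rewrite unitZpE.
rewrite /corr -(card_imset [set x in A | x + i \in A] (mulrI Ud)).
apply: eq_card => x; apply/idP/imsetP => [|[y]].
  rewrite inE -[x](mulVKr Ud) -mulrDr !in_dilate // => xA.
  by exists (d%:R^-1 * x); rewrite ?inE.
by rewrite inE => yA ->; rewrite inE -mulrDr !in_dilate.
Qed.

Lemma is_sds_dilate r k l d A B : coprime v d ->
  is_sds r k l A B -> is_sds r k l (dilate d A) (dilate d B).
Proof.
move=> cd [cA cB H]; have Ud : (d%:R : 'Z_v) \is a GRing.unit by rewrite unitZpE.
split; rewrite ?card_dilate // => i i0.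
rewrite !diff_countE -[i](mulVKr Ud) !corr_dilate // -!diff_countE; apply: H.
by rewrite -[X in _ != X](mulr0 (d%:R^-1)) (inj_eq (mulrI _)) ?unitrV.
Qed.

Lemma skew_dilate d A : coprime v d -> skew_set A -> skew_set (dilate d A).
Proof.
move=> cd [A0 AN]; have Ud : (d%:R : 'Z_v) \is a GRing.unit by rewrite unitZpE.
split; first by rewrite -(mulr0 d%:R) in_dilate.
move=> x x0; rewrite -[x](mulVKr Ud) -mulrN !in_dilate //; apply: AN.
by rewrite -[X in _ != X](mulr0 (d%:R^-1)) (inj_eq (mulrI _)) ?unitrV.
Qed.

Lemma dilateN1 A x : (x \in dilate v.-1 A) = (- x \in A).
Proof.
have vE : v.-1%:R = -1 :> 'Z_v.
  by rewrite -subn1 natrN_Zv // ltnW.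
apply/imsetP/idP => [[y yA ->]|xA]; first by rewrite vE mulN1r opprK.
by exists (- x); rewrite // vE mulN1r opprK.
Qed.

Lemma corrC B d : (corr (~: B) d + 2 * #|B| = v + corr B d)%N.
Proof.
apply/eqP; rewrite mul2n -addnn -(eqr_nat Z) !natrD -!autocorr_indic; apply/eqP.
have iC x : indic Z (~: B) x = 1 - indic Z B x.
  by rewrite /indic inE; case: (x \in B); rewrite ?subrr ?subr0.
rewrite /autocorr; under eq_bigr => x _ do rewrite !iC mulrBl mul1r mulrBr mulr1 opprB addrCA.
rewrite 2!big_split /= sumrN !sumrB sumr_const -(sum_indic Z B).
have -> : \sum_x indic Z B (x + d) = \sum_x indic Z B x by rewrite [RHS](reindex_inj (addIr d)).
by rewrite card_Zv //; ring.
Qed.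

Lemma is_sds_setC r k l A B : is_sds r k l A B -> (k <= v)%N -> (2 * k <= v + l)%N ->
  is_sds r (v - k) (l + v - 2 * k) A (~: B).
Proof.
move=> [cA cB H] kv kl; split=> //.
  by apply/eqP; rewrite -(eqn_add2l #|B|) cardsC cB card_Zv // subnKC.
move=> i i0; have := H i i0; have := corrC B i.
by rewrite !diff_countE cB; lia.
Qed.

(** The difference counts of a set [D] over all [d] sum to [#|D| ^ 2], and the count at 0 is
    [#|D|]. *)
Lemma is_sds_card r k l A B : is_sds r k l A B ->
  (l * v.-1 + r + k = r ^ 2 + k ^ 2)%N.
Proof.
move=> [cA cB H]; apply/eqP; rewrite -(eqr_nat Z); apply/eqP.
have SE (D : {set 'Z_v}) : \sum_d ((corr D d)%:R : Z) = #|D|%:R ^+ 2.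
  rewrite -(sum_indic Z D) -autocorr_ge; apply: eq_bigr => d _.
  by rewrite autocorr_indic.
rewrite [RHS]natrD !natrX -cA -cB -!SE -big_split /= (bigD1 0) //= !corr0.
under eq_bigr => d d0 do rewrite -natrD -!diff_countE H //.
rewrite sumr_const (eq_card (B := predC1 (0 : 'Z_v))) // cardC1 card_Zv //.
by rewrite !natrD mulrnA -addrA addrC cA cB.
Qed.

(** The sign function is odd, so it sums to 0; by [skew_signE] the sum is also [2 #|A| - v + 1]. *)
Lemma skew_card A : skew_set A -> #|A| = v./2.
Proof.
move=> skA; have := sum_indic Z A.
have : \sum_x skew_sign Z A x = 0.
  rewrite /skew_sign sumrB [X in _ - X](_ : _ = \sum_x indic Z A x) ?subrr //.
  by rewrite [RHS](reindex_inj oppr_inj).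
under eq_bigr => x _ do rewrite skew_signE // -[(x == 0)%:R]mul1r -{2}[x]addr0.
rewrite big_split /= sum_delta sumrB sumrMnl sumr_const card_Zv // => E1 E2.
rewrite E2 in E1; move: E1; set a := #|A| => E1.
have : (a * 2 + 1 = v)%N by lia.
by lia.
Qed.

End Moves.

(* [stab] consists of the [d] with [d T = T] or [d T = - T]: these
  moves relate two blocks [B] having the same [A]. *)
Definition accept_entry (v : nat) (T t : seq nat) : seq nat -> bool :=
  let stab := [seq d <- iota 1 v.-1 | coprime v d &&
    (all (fun x => d * x %% v \in T) T || all (fun x => v - d * x %% v \in T) T)%N] in
  fun s => has (fun d => has (fun a => (size s == size t) &&
             all (fun x => (d * x + a) %% v \in s) t) (iota 0 v))%N stab.

Definition table_entry (v k : nat) (T : seq nat) : option (seq nat) :=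
  ohead [seq e.2 | e <- sds_table &
         [&& e.1.1.1.1.1 == v, e.1.1.1.2 == k & e.1.2 == T]].

Definition accept_table (v k : nat) (T : seq nat) : seq nat -> bool :=
  if table_entry v k T is Some t then accept_entry v T t else xpred0.

Lemma accept_tableP v k T s : accept_table v k T s ->
  exists2 t, table_entry v k T = Some t & accept_entry v T t s.
Proof. by rewrite /accept_table; case: table_entry => // t; exists t. Qed.

(** * Verification of the table and equivalence with its entries *)

Definition entry_ok (e : (nat * nat * nat * nat) * seq nat * seq nat) : bool :=
  let: ((v, r, k, l), s, t) := e in
  [&& (1 < v)%N, odd v, uniq s, uniq t & all (fun x => x < v)%N (s ++ t)] &&
  [&& size s == r, size t == k &
      all (fun d => seq_corr v s d + seq_corr v t d == l)%N (iota 1 v./2)].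

(** The counts at [d] and [- d] agree, so testing [1, ..., v./2] is enough. *)
Lemma entry_ok_sds v r k l s t : entry_ok ((v, r, k, l), s, t) ->
  [/\ is_sds r k l (residues v s) (residues v t), uniq s, uniq t,
      all (fun x => x < v)%N s & all (fun x => x < v)%N t].
Proof.
move=> /andP[/and5P[v1 vo us ut]]; rewrite all_cat => /andP[sv tv] /and3P[/eqP cs /eqP ct /allP H].
split=> //; split; rewrite ?card_residues // => i i0; rewrite !diff_countE.
have key d : (0 < d <= v./2)%N ->
    (corr (residues v s) (d%:R : 'Z_v) + corr (residues v t) (d%:R : 'Z_v) = l)%N.
  by move=> dv; rewrite !seq_corrE //; apply/eqP/H; rewrite mem_iota; lia.
have iv : (i < v)%N by rewrite -[X in (_ < X)%N]Zp_cast.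
have ip : (0 < i)%N by rewrite lt0n -(inj_eq val_inj) in i0 *.
case: (leqP i v./2) => im; first by rewrite -[i]natr_Zp key ?ip.
rewrite -corrN -[corr (residues v t) i]corrN -[i]natr_Zp -natrN_Zv ?(ltnW iv) //.
by apply: key; lia.
Qed.

Lemma all_entries_ok : all entry_ok sds_table.
Proof. by vm_cast_no_check (@erefl bool true). Qed.

Lemma table_entryP v k T t : table_entry v k T = Some t ->
  exists r l, [/\ ((v, r, k, l), T, t) \in sds_table & entry_ok ((v, r, k, l), T, t)].
Proof.
rewrite /table_entry; move: all_entries_ok; move: (sds_table) => S /allP okS H.
have : t \in [seq e.2 | e <- S & [&& e.1.1.1.1.1 == v, e.1.1.1.2 == k & e.1.2 == T]].
  by move: H; case: [seq _ | _ <- _ & _] => //= ? ? [->]; rewrite mem_head.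
case/mapP => -[[[[[v' r] k'] l] T'] t'].
rewrite mem_filter => /andP[/and3P[/= /eqP-> /eqP-> /eqP->] tin] /= ->.
by exists r, l; split=> //; exact: (okS _ tin).
Qed.

Lemma residues_sub_eq v (A : {set 'Z_v}) s : (1 < v)%N -> uniq s ->
  all (fun x => x < v)%N s -> #|A| = size s -> (forall x, x \in A -> nat_of_ord x \in s) ->
  A = residues v s.
Proof.
move=> v1 us sv cA H; apply/eqP; rewrite eqEcard card_residues // cA leqnn andbT.
by apply/subsetP => x /H; rewrite in_residues.
Qed.

Lemma sds_equiv_sym v (X Y : {set 'Z_v} * {set 'Z_v}) : sds_equiv X Y -> sds_equiv Y X.
Proof. exact: rst_sym. Qed.

Lemma sds_equiv_trans v (X Y W : {set 'Z_v} * {set 'Z_v}) :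
  sds_equiv X Y -> sds_equiv Y W -> sds_equiv X W.
Proof. exact: rst_trans. Qed.

Lemma signed_shift00 v (A : {set 'Z_v}) : signed_shift false 0 A = A.
Proof.
by apply/setP => x; rewrite -[signed_shift _ _ _]/(translate 0 A) in_translate subr0.
Qed.

Lemma sds_equiv_translate v (a : 'Z_v) (A B : {set 'Z_v}) : sds_equiv (A, B) (A, translate a B).
Proof.
by apply: rst_step; have := Sds_shift A B false false 0 a; rewrite signed_shift00.
Qed.

Lemma accept_entryP v T t s : (1 < v)%N -> accept_entry v T t s ->
  uniq T -> all (fun x => x < v)%N T -> uniq t -> all (fun x => x < v)%N t ->
  uniq s -> all (fun x => x < v)%N s ->
  sds_equiv (residues v T, residues v s) (residues v T, residues v t).
Proof.
move=> v1 + uT Tv ut tv us sv; have v0 : (0 < v)%N by exact: ltnW.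
move=> /hasP[d + /hasP[a _ /andP[/eqP szst /allP Ht]]].
rewrite mem_filter mem_iota => /andP[/andP[cd stab] dv].
have Ud : (d%:R : 'Z_v) \is a GRing.unit by rewrite unitZpE.
apply: sds_equiv_sym.
apply: (@sds_equiv_trans _ _ (dilate d (residues v T), dilate d (residues v t))).
  by apply: rst_step; apply: Sds_dilate; rewrite 1?coprime_sym //; lia.
(* Dilation by [d] sends [T] to itself or to its negative, and the sign available in a shift undoes
   the latter. *)
have [sg sgE] : exists sg, signed_shift sg 0 (dilate d (residues v T)) = residues v T.
  case/orP: stab => /allP stab; [exists false|exists true]; apply: residues_sub_eq => //;
    rewrite ?(card_translate 0) ?card_dilate ?card_residues //.
  - move=> y; rewrite signed_shift00 => /imsetP[x]; rewrite in_residues // => xT ->.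
    by rewrite -[x]natr_Zp -natrM val_natr_Zv // stab.
  - rewrite card_imset; first by rewrite card_dilate ?card_residues.
    by move=> x y; rewrite expr1 !addr0; apply: mulrI; rewrite unitrN1.
  move=> y /imsetP[z /imsetP[x]]; rewrite in_residues // => xT -> ->.
  rewrite expr1 mulN1r addr0 -[x]natr_Zp -natrM -(natr_modv _ v1).
  have := stab _ xT; set m := (_ %% v)%N => mT.
  have mv : (m < v)%N by rewrite ltn_mod.
  by rewrite -natrN_Zv ?(ltnW mv) // val_natr_Zv // modn_small // (allP Tv).
apply: rst_step.
have := Sds_shift (dilate d (residues v T)) (dilate d (residues v t)) sg false 0 a%:R.
rewrite sgE; suff -> : signed_shift false a%:R (dilate d (residues v t)) = residues v s by [].
apply/eqP; rewrite eqEcard card_translate card_dilate // !card_residues // szst leqnn andbT.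
apply/subsetP => y /imsetP[z /imsetP[x + -> ->]].
rewrite inE => /mapP[n nt ->]; rewrite expr0 mul1r -natrM -natrD -(natr_modv _ v1).
by rewrite residues_natr ?ltn_mod // Ht.
Qed.

(** * Arithmetic obstructions *)

Section SelfConjugate.
Variables (v e : nat).
Hypotheses (v_gt1 : (1 < v)%N) (e_gt0 : (0 < e)%N) (minus1 : (2 ^ e = v.-1 %[mod v])%N).
Implicit Types B : {set 'Z_v}.

Lemma pchar_polyF2 : 2 \in [pchar {poly 'F_2}].
Proof. by rewrite (pchar_lalg {poly 'F_2}); exact: pchar_Fp. Qed.

Lemma frobenius_sum (I : finType) (P : pred I) (F : I -> nat) n :
  (\sum_(i | P i) 'X^(F i)) ^+ (2 ^ n) = \sum_(i | P i) 'X^(F i * 2 ^ n) :> {poly 'F_2}.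
Proof.
elim: n => [|n IH]; first by rewrite expn0 expr1; apply: eq_bigr => i _; rewrite muln1.
rewrite {1}expnSr exprM IH -(pFrobenius_autE pchar_polyF2) rmorph_sum /=.
by apply: eq_bigr => i _; rewrite pFrobenius_autE -exprM -mulnA -expnSr.
Qed.

Lemma dvdp_XmodSub n : ('X^v - 1 : {poly 'F_2}) %| 'X^n - 'X^(n %% v).
Proof.
rewrite {1}(divn_eq n v) exprD mulnC exprM -[X in _ %| _ - X]mul1r -mulrBl dvdp_mulr //.
by rewrite [X in _ %| X]subrX1 dvdp_mulr.
Qed.

Lemma exp2_Zv : (2 ^ e)%:R = -1 :> 'Z_v.
Proof. by rewrite -(natr_modv _ v_gt1) minus1 natr_modv // -subn1 natrN_Zv // ltnW. Qed.

Lemma dvdp_Xsub i j : (i = j %[mod v])%N -> ('X^v - 1 : {poly 'F_2}) %| 'X^i - 'X^j.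
Proof.
move=> ij; rewrite -(subrK 'X^(i %% v) 'X^i) -addrA {2}ij dvdp_add ?dvdp_XmodSub //.
by rewrite -dvdpNr opprB dvdp_XmodSub.
Qed.

(* Let [b] be the polynomial of [B] over F_2.  Modulo [X^v - 1], [b(X^-1)] is
  [b^(2^e)], so by hypothesis [b^(1 + 2^e)] is [1 + X + ... + X^(v-1)], and a power of
  [(X - 1) b] vanishes.  As [c^(4^e)] is [c] modulo [X^v - 1], so does [(X - 1) b]. *)
Lemma self_conjugate_const B :
  odd #|B| -> (forall d, d != 0 -> odd (corr B d)) -> forall x, x \in B.
Proof.
move=> oB oc.
pose b : {poly 'F_2} := \sum_(x in B) 'X^(nat_of_ord x).
pose m : {poly 'F_2} := 'X^v - 1.
have bC i : (i < v)%N -> b`_i = ((i%:R : 'Z_v) \in B)%:R.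
  move=> iv; rewrite coef_sum; under eq_bigr => x _ do rewrite coefXn.
  rewrite big_mkcond (bigD1 (i%:R : 'Z_v)) //= val_natr_Zv // modn_small // eqxx.
  rewrite big1 ?addr0 => [|x xi]; first by case: (_ \in B).
  case: (x \in B) => //; case: eqP => // ix; case/eqP: xi.
  by rewrite ix natr_Zp.
have szb : (size b <= v)%N.
  apply: (leq_trans (size_sum _ _ _)); apply/bigmax_leqP => x _.
  by rewrite size_polyXn -[X in (_ < X)%N]Zp_cast.
have key : m %| ('X - 1) * (b * b ^+ (2 ^ e)).
  have E : m %| b * b ^+ (2 ^ e) - \sum_(i < v) 'X^i.
    rewrite {2}/b frobenius_sum big_distrlr /=.
    have -> : \sum_(i < v) 'X^i = \sum_(x in B) \sum_(y in B)
        'X^((nat_of_ord x + nat_of_ord y * 2 ^ e) %% v) :> {poly 'F_2}.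
      (* All counts are odd, including the one at 0, which is [#|B|]; over F_2 every coefficient is
         therefore 1. *)
      transitivity (\sum_d 'X^(nat_of_ord d) *+ corr B d : {poly 'F_2}).
        rewrite (sum_ZvE v_gt1) big_mkord; apply: eq_bigr => i _.
        rewrite val_natr_Zv // modn_small // -[corr _ _]odd_double_half.
        have -> : odd (corr B i%:R).
          by case: (eqVneq (i%:R : 'Z_v) 0) => [->|/oc //]; rewrite corr0.
        rewrite mulrnDr -mul2n mulrnA -[_ *+ 2]mulr_natl (pcharf0 pchar_polyF2).
        by rewrite mul0r mul0rn addr0.
      under eq_bigr => d _ do rewrite -sumr_const.
      rewrite (exchange_big_dep (mem B)) /=; last by move=> d x _; rewrite inE => /andP[].
      rewrite [RHS]exchange_big /=; apply: eq_bigr => x xB.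
      rewrite [RHS](reindex_inj (addrI x)); apply: eq_big => [d|d _].
        by rewrite inE xB.
      rewrite -val_natr_Zv // natrD natrM !natr_Zp.
      rewrite exp2_Zv.
      by rewrite mulrN1 addrC addKr.
    rewrite -sumrB; apply: (big_ind (fun p => m %| p)); rewrite ?dvdp0 //; first exact: dvdp_add.
    move=> x _; rewrite -sumrB.
    apply: (big_ind (fun p => m %| p)); rewrite ?dvdp0 //; first exact: dvdp_add.
    by move=> y _; rewrite -exprD; exact: dvdp_XmodSub.
  have : m %| ('X - 1) * (b * b ^+ (2 ^ e) - \sum_(i < v) 'X^i) by rewrite dvdp_mull.
  by rewrite mulrBr -subrX1 dvdp_subl.
have two_e : (2 ^ (e + e) = 1 %[mod v])%N.
  by rewrite -!val_natr_Zv // expnD natrM exp2_Zv mulrNN mulr1.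
(* The product [('X - 1) * b] as a sum of monomials, possible since -1 = 1, so that [frobenius_sum]
   applies to it. *)
pose c : {poly 'F_2} := \sum_(p : 'Z_v * bool | p.1 \in B) 'X^(p.1 + p.2).
have cE : c = ('X - 1) * b.
  have -> : c = \sum_(x in B) \sum_(s : bool) 'X^(x + s).
    by rewrite pair_big; apply: eq_bigl => p; rewrite andbT.
  rewrite mulr_sumr; apply: eq_bigr => x _; rewrite big_bool /= addn1 addn0.
  by rewrite mulrBl mul1r -exprS (oppr_pchar2 pchar_polyF2).
(* The exponent [2 ^ (e + e)] is 1 modulo [v], hence [c] and its power agree modulo [m]; it is also
   at least [1 + 2 ^ e], so [key] kills the power. *)
have mc : m %| c.
  rewrite -(subrK (c ^+ (2 ^ (e + e))) c) dvdp_add //.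
    rewrite /c frobenius_sum -sumrB.
    apply: (big_ind (fun p => m %| p)); rewrite ?dvdp0 //; first exact: dvdp_add.
    move=> p _; apply: dvdp_Xsub.
    by rewrite -modnMmr two_e modnMmr muln1.
  rewrite cE exprMn (dvdp_trans key) // dvdp_mul //.
    by rewrite -[X in X %| _]expr1 dvdp_exp2l // expn_gt0.
  rewrite -exprS dvdp_exp2l // expnD.
  have h : (1 < 2 ^ e)%N by rewrite -(expn0 2) ltn_exp2l.
  by apply: (leq_trans (n := (2 ^ e * 2)%N)); [lia|rewrite leq_mul2l h orbT].
have szm : size m = v.+1 by rewrite size_XnsubC // ltnW.
have /dvdpP[q cq] := mc.
have m0 : m != 0 by rewrite -size_poly_eq0 szm.
(* By degrees the cofactor is constant, so the coefficients of [c] at [0 < i < v] vanish and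
   consecutive coefficients of [b] agree. *)
have szq : (size q <= 1)%N.
  case: (eqVneq q 0) => [->|q0]; first by rewrite size_poly0.
  have := congr1 (fun p : {poly 'F_2} => size p) cq; rewrite size_mul // szm addnS /= cE.
  have s2 : size ('X - 1 : {poly 'F_2}) = 2%N by exact: size_XsubC.
  have := size_mul_leq ('X - 1) b; rewrite s2 => h1 h2.
  have : (size q + v <= (2 + size b).-1)%N by rewrite -h2.
  by move: szb; clear; move: (size b) (size q) => i j; lia.
have step i : (0 < i < v)%N -> (i%:R : 'Z_v) \in B = (i.-1%:R \in B).
  move=> /andP[i0 iv]; have := congr1 (fun p : {poly 'F_2} => p`_i) cq.
  rewrite cE mulrBl mul1r coefB coefXM (size1_polyC szq) mul_polyC coefZ.
  rewrite coefB coefXn coef1 (ltn_eqF iv) (gtn_eqF i0).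
  rewrite subrr mulr0 !bC ?(leq_ltn_trans (leq_pred i) iv) //.
  by case: (_ \in B); case: (_ \in B).
have all_eq i : (i < v)%N -> (i%:R : 'Z_v) \in B = (0 \in B).
  elim: i => [|i IH] iv //; by rewrite step //= IH // ltnW.
have Bx x : (x \in B) = (0 \in B).
  by rewrite -[x]natr_Zp all_eq // -[X in (_ < X)%N]Zp_cast.
move=> x; rewrite Bx; apply: contraLR oB => B0.
by rewrite (eq_card0 (A := B)) // => y; rewrite Bx (negbTE B0).
Qed.
End SelfConjugate.

(* [z ^ n = u_n + w_n z] whenever [z ^ 2 = t z - 1], where [(u_n, w_n) = lucas t n]. *)
Fixpoint lucas (t : Z) (n : nat) : Z * Z :=
  if n is n'.+1 then let (u, w) := lucas t n' in (Z.opp w, Z.add u (Z.mul t w))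
  else (Zpos xH, Z0).

Definition zdvd (a b : Z) := exists k : Z, b = k * a.
Arguments zdvd (a b)%_ring_scope.

Lemma zdvdD a b c : zdvd a b -> zdvd a c -> zdvd a (b + c).
Proof. by move=> [i ->] [j ->]; exists (i + j); rewrite mulrDl. Qed.

Lemma zdvdN a b : zdvd a b -> zdvd a (- b).
Proof. by move=> [i ->]; exists (- i); rewrite mulNr. Qed.

Lemma zdvd_mulr a b c : zdvd a b -> zdvd a (b * c).
Proof. by move=> [i ->]; exists (i * c); rewrite mulrAC. Qed.

(** * Norms from a quadratic extension that is inert at [l] *)

Section InertPrime.
Variables (v l : nat) (t : Z).
Hypotheses (v_gt1 : (1 < v)%N) (l_prime : prime l).
Let L := Z.of_nat l.
Let u n := (lucas t n).1.
Let w n := (lucas t n).2.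
Hypotheses (u_v : zdvd (L * L) (u v - 1)) (w_v : zdvd (L * L) (w v)).
Hypotheses (cop : coprime v l.-1) (t_ne2 : ~ zdvd (L) (t - 2)).
Implicit Types B : {set 'Z_v}.

Lemma lucasS n : (u n.+1 = - w n) * (w n.+1 = u n + t * w n).
Proof. by rewrite /u /w /=; case: (lucas t n). Qed.

(** With [z ^ -1 = t - z], this is the constant coordinate of [z ^ x * z ^ - y] in the basis [1, z];
    hence its invariance under shifting both exponents. *)
Definition lucas_form x y := u x * u y + t * u x * w y + w x * w y.

Lemma lucas_form_shift n x y : lucas_form (x + n)%N (y + n)%N = lucas_form x y.
Proof.
elim: n => [|n IH]; first by rewrite !addn0.
by rewrite !addnS -[RHS]IH /lucas_form !lucasS; ring.
Qed.

(** For [y <= x] the form equals [u (x - y)]; otherwise the exponent is raised by [v], using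
    [z ^ v = 1] modulo [L * L]. *)
Lemma lucas_form_mod x y : (x < v)%N -> (y < v)%N ->
  zdvd (L * L) (lucas_form x y - u ((x + (v - y)) %% v)%N).
Proof.
move=> xv yv; case: (leqP y x) => xy.
  have -> : ((x + (v - y)) %% v = x - y)%N.
    have -> : (x + (v - y) = x - y + v)%N by lia.
    by rewrite modnDr modn_small //; lia.
  have := lucas_form_shift y (x - y)%N 0%N; rewrite subnK // add0n => ->.
  have -> : lucas_form (x - y)%N 0%N = u (x - y)%N.
    by rewrite /lucas_form /w /u /= mulr1 mulr0 mulr0 !addr0.
  by exists 0; rewrite mul0r subrr.
rewrite modn_small; last by lia.
have := lucas_form_shift x 0%N (y - x)%N; rewrite subnK ?(ltnW xy) // add0n => ->.
have -> : (x + (v - y) = v - (y - x))%N by lia.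
set d := (y - x)%N; have dv : (d <= v)%N by rewrite /d; lia.
have := lucas_form_shift d (v - d)%N 0%N; rewrite subnK // add0n => H.
have -> : u (v - d)%N = lucas_form v d by rewrite H /lucas_form /u /w /=; ring.
have -> : (lucas_form 0%N d - lucas_form v d =
    - (u v - 1) * (u d + t * w d) + - w v * w d :> Z).
  by rewrite /lucas_form {1 3 5}/u {2}/w /=; ring.
by apply: zdvdD; apply: zdvd_mulr; apply: zdvdN.
Qed.

Definition Fl (z : Z) : 'F_l := (int_of_Z z)%:~R.

Lemma FlD x y : Fl (x + y) = Fl x + Fl y.
Proof. by rewrite /Fl rmorphD rmorphD. Qed.

Lemma FlM x y : Fl (x * y) = Fl x * Fl y.
Proof. by rewrite /Fl rmorphM rmorphM. Qed.

Lemma FlN x : Fl (- x) = - Fl x.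
Proof. by rewrite /Fl rmorphN rmorphN. Qed.

Lemma Fl_eq0 z : Fl z = 0 <-> zdvd L z.
Proof.
have FlL : Fl L = 0.
  have -> : Fl L = l%:R by rewrite /Fl /L -[Z.of_nat l]/(Z_of_int l) Z_of_intK.
  by apply: pcharf0; exact: pchar_Fp.
split; last by move=> [k ->]; rewrite FlM FlL mulr0.
have l0 : (0 < l)%N by exact: prime_gt0.
pose r := Z.to_nat (Z.modulo z L).
have L0 : Z.lt Z0 L by rewrite /L; lia.
have [zE rl] : z = Z.div z L * L + Z.of_nat r /\ (r < l)%N.
  have := Z.mod_pos_bound z L L0; have := Z.div_mod z L.
  rewrite /r /L; move: (Z.div _ _) (Z.modulo _ _) => d m.
  move=> E bd; split; last by lia.
  by rewrite Z2Nat.id; [rewrite mulrC E //; lia|lia].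
rewrite {1}zE FlD FlM FlL mulr0 add0r /Fl -[Z.of_nat r]/(Z_of_int r) Z_of_intK => r0.
have : (l %| r)%N by rewrite (dvdn_pcharf (pchar_Fp l_prime)); apply/eqP.
move=> lr; exists (Z.div z L); rewrite {1}zE.
suff -> : r = 0%N by rewrite addr0.
by case: (posnP r) => // r1; rewrite gtnNdvd in lr.
Qed.

(** If [q] is nonzero modulo [l], then [s = - p / q] is a root of [X^2 - t X + 1] in F_l. Then
    [s ^ v = 1] by the Lucas relations and [s ^ (l - 1) = 1] by Fermat, so [s = 1] by coprimality
    and [t = 2] modulo [l], which is excluded. *)
Lemma inert_isotropic p q : zdvd L (p ^+ 2 + t * p * q + q ^+ 2) -> zdvd L p /\ zdvd L q.
Proof.
move=> /Fl_eq0; rewrite !expr2 !(FlD, FlM) => H.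
have [q0|q0] := eqVneq (Fl q) 0.
  move: H; rewrite q0 !mulr0 !addr0 => /eqP; rewrite mulf_eq0 orbb => /eqP p0.
  by split; apply/Fl_eq0.
exfalso; pose s := - Fl p / Fl q.
have s2 : s ^+ 2 = Fl t * s - 1.
  have q2 : Fl q ^+ 2 != 0 by rewrite expf_neq0.
  have sq : s * Fl q = - Fl p by rewrite divfK.
  apply: (mulIf q2); apply: subr0_eq.
  have -> : s ^+ 2 * Fl q ^+ 2 - (Fl t * s - 1) * Fl q ^+ 2 =
    (s * Fl q) * (s * Fl q) - Fl t * (s * Fl q) * Fl q + Fl q * Fl q by ring.
  by rewrite sq -[RHS]H; ring.
have sE n : s ^+ n = Fl (u n) + Fl (w n) * s.
  elim: n => [|n IH].
    have -> : Fl (u 0%N) = 1 by [].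
    have -> : Fl (w 0%N) = 0 by [].
    by rewrite mul0r addr0.
  rewrite exprSr IH !lucasS FlN FlD FlM mulrDl -mulrA -expr2 s2; ring.
have u1 : Fl (u v) = 1.
  have /Fl_eq0 : zdvd L (u v - 1).
    by case: u_v => k ->; exists (k * L); rewrite mulrA.
  by rewrite FlD FlN => /eqP; rewrite subr_eq0 => /eqP.
have w0 : Fl (w v) = 0.
  by apply/Fl_eq0; case: w_v => k ->; exists (k * L); rewrite mulrA.
have sv : s ^+ v = 1 by rewrite sE u1 w0 mul0r addr0.
have s0 : s != 0.
  apply/eqP => s0; move: sv; rewrite s0 expr0n.
  by case: (v) v_gt1 => // n _ /eqP; rewrite eq_sym oner_eq0.
have l1 : (0 < l.-1)%N by have := prime_gt1 l_prime; lia.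
have sl : s ^+ l.-1 = 1.
  apply: (mulIf s0); rewrite -exprSr prednK ?prime_gt0 // mul1r.
  by rewrite -[s]natr_Zp -(pFrobenius_autE (pchar_Fp l_prime)) pFrobenius_aut_nat.
have [a _ /dvdnP[k Hk]] := Bezoutl v l1.
have s1 : s = 1.
  have : s ^+ (1 + a * v) = 1.
    have <- : gcdn l.-1 v = 1%N by apply/eqP; rewrite -/(coprime _ _) coprime_sym.
    by rewrite Hk mulnC exprM sl expr1n.
  by rewrite exprD expr1 mulnC exprM sv expr1n mulr1.
apply: t_ne2; apply/Fl_eq0; rewrite FlD FlN.
have -> : Fl 2 = 1 + 1 by [].
by move/eqP: s2; rewrite s1 expr1n mulr1 eq_sym subr_eq => /eqP ->; rewrite subrr.
Qed.

(* The sum is congruent to the value of the form [p^2 + t p q + q^2], the norm of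
  [p + q z]; it is anisotropic modulo [l], so it cannot be exactly divisible by [l]. *)
Lemma no_exact_inert_factor B (r : Z) : zdvd L r -> ~ zdvd (L * L) r ->
  ~ zdvd (L * L) (\sum_(d : 'Z_v) (corr B d)%:R * u (nat_of_ord d) - r).
Proof.
move=> Lr nLr Hr.
(* Thus [p + q z] is the sum of [z ^ x] over [B]. *)
pose p := \sum_(x in B) u (nat_of_ord x); pose q := \sum_(x in B) w (nat_of_ord x).
have nE : p ^+ 2 + t * p * q + q ^+ 2 =
    \sum_(x in B) \sum_(y in B) lucas_form (nat_of_ord x) (nat_of_ord y).
  rewrite /lucas_form !expr2 -mulrA /p /q !big_distrlr /= mulr_sumr -!big_split /=.
  apply: eq_bigr => x _; rewrite mulr_sumr -!big_split /=.
  by apply: eq_bigr => y _; rewrite mulrA.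
have xv (x : 'Z_v) : (x < v)%N by rewrite -[X in (_ < X)%N]Zp_cast.
have cE : \sum_(d : 'Z_v) (corr B d)%:R * u (nat_of_ord d) =
    \sum_(x in B) \sum_(y in B) u ((x + (v - y)) %% v)%N.
  under eq_bigr => d _ do rewrite mulr_natl -sumr_const.
  rewrite (exchange_big_dep (mem B)) /=; last by move=> d x _; rewrite inE => /andP[].
  rewrite [RHS]exchange_big /=; apply: eq_bigr => x xB.
  rewrite [RHS](reindex_inj (addrI x)); apply: eq_big => [d|d _]; first by rewrite inE xB.
  congr (u _); rewrite -val_natr_Zv // natrD natrN_Zv ?(ltnW (xv x)) // !natr_Zp.
  by rewrite addrC addKr.
have Hn : zdvd (L * L) (p ^+ 2 + t * p * q + q ^+ 2 - r).
  rewrite nE -(subrK (\sum_(d : 'Z_v) (corr B d)%:R * u (nat_of_ord d))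
    (\sum_(x in B) _)) -addrA; apply: zdvdD => //.
  rewrite cE -sumrB.
  apply: (big_ind (zdvd (L * L))); [by exists 0; rewrite mul0r|exact: zdvdD|].
  move=> x _; rewrite -sumrB.
  apply: (big_ind (zdvd (L * L))); [by exists 0; rewrite mul0r|exact: zdvdD|].
  by move=> y _; apply: lucas_form_mod.
have [|[i pi] [j qj]] := @inert_isotropic p q.
  rewrite -(subrK r (_ + _)); apply: zdvdD => //.
  by case: Hn => k ->; exists (k * L); rewrite mulrA.
apply: nLr; have -> : r = (p ^+ 2 + t * p * q + q ^+ 2) - (p ^+ 2 + t * p * q + q ^+ 2 - r).
  by rewrite opprB addrC subrK.
apply: zdvdD; last exact: zdvdN.
by exists (i ^+ 2 + t * i * j + j ^+ 2); rewrite pi qj; ring.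
Qed.

End InertPrime.

(** * The case of [v = 51] with an empty second block *)

Lemma sqr_ne17 (a : Z) : a * a <> 17.
Proof.
have lt5 (b : Z) : b * b = 17 -> b < 5.
  move=> bb; rewrite ltNge; apply/negP => b5.
  by have : 5 * 5 <= b * b by [rewrite ler_pM]; rewrite bb.
move=> H; have := lt5 _ H; have := lt5 (- a); rewrite mulrNN => /(_ H) {lt5} h1 h2.
have : a = -4 \/ a = -3 \/ a = -2 \/ a = -1 \/ a = 0 \/ a = 1 \/ a = 2 \/ a = 3 \/ a = 4 by lia.
by move: H => /[swap]; do 8 (case=> [->//|]); move=> ->.
Qed.

Lemma sum_nonmultiples3 (a : Z) :
  \sum_(0 <= n < 51) (if (3 %| n)%N then 0 else a) = 34 * a.
Proof.
transitivity (\sum_(0 <= n < 51) ((~~ (3 %| n)%N)%:R : Z) * a).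
  by apply: eq_bigr => n _; case: ifP; rewrite ?mul0r ?mul1r.
rewrite -big_distrl; congr (_ * _); rewrite -zsumE.
by vm_cast_no_check (@erefl Z 34).
Qed.

Lemma sum_multiples3 : \sum_(0 <= n < 51) ((3 %| n)%N%:R : Z) = 17.
Proof. by rewrite -zsumE; vm_cast_no_check (@erefl Z 17). Qed.

(* [T] is the image of [S] in [Z/3]; being odd it takes the values [0, a, -a], and its
  energy forces [a^2 = 17]. *)
Lemma no_paley_51 v r l (A : {set 'Z_v}) : v = 51%N -> is_sds r 0 l A set0 -> ~ skew_set A.
Proof.
move=> v51 sds skA; have v1 : (1 < v)%N by rewrite v51.
have vo : odd v by rewrite v51.
have r25 : r = 25%N by case: sds => <- _ _; rewrite (skew_card v1) // v51.
have l12 : l = 12%N by have := is_sds_card v1 sds; rewrite r25 v51; lia.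
pose S := skew_sign Z A; pose g (y : 'Z_v) : Z := (3 %| y)%N%:R.
pose T x := \sum_y S y * g (x - y).
have v3 : (3 %| v)%N by rewrite v51.
have gE n : g n%:R = (3 %| n)%N%:R.
  by rewrite /g val_natr_Zv // /dvdn modn_dvdm.
have g3 y : g (y + 3%:R) = g y by rewrite -[y]natr_Zp -natrD !gE dvdn_addl.
have gN y : g (- y) = g y.
  have yv : (y < v)%N by rewrite -[X in (_ < X)%N]Zp_cast.
  by rewrite -[y]natr_Zp -natrN_Zv ?(ltnW yv) // !gE dvdn_subr // ltnW.
have T3 x : T (x + 3%:R) = T x by apply: eq_bigr => y _; rewrite addrAC g3.
have TN x : T (- x) = - T x.
  rewrite /T (reindex_inj oppr_inj) -sumrN; apply: eq_bigr => y _.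
  by rewrite /S skew_signN mulNr -opprD gN.
have T0 : T 0 = 0 by have := TN 0; rewrite oppr0; move: (T 0) => z; lia.
have Tmul q m : T (3 * q + m)%:R = T m%:R.
  elim: q => // q IH; rewrite mulnS -addnA natrD addrC T3; exact: IH.
have Tn n : T n%:R ^+ 2 = if (3 %| n)%N then 0 else T 1 ^+ 2.
  rewrite {1}(divn_eq n 3) mulnC Tmul /dvdn.
  have : (n %% 3 < 3)%N by rewrite ltn_mod.
  case: (n %% 3)%N => [|[|[|//]]] _ /=; first by rewrite T0 expr0n.
    by [].
  (* The residue -1 is represented by 50 = 3 * 16 + 2. *)
  have -> : T 2%:R = T (- 1%:R).
    rewrite -natrN_Zv //; last by rewrite v51.
    by rewrite -(Tmul 16); congr (T _%:R); rewrite v51.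
  by rewrite TN sqrrN.
have sumv (F : nat -> Z) : \sum_(0 <= n < v) F n = \sum_(0 <= n < 51) F n by rewrite v51.
have sumT : \sum_x T x ^+ 2 = 34 * T 1 ^+ 2.
  by rewrite (sum_ZvE v1) sumv -sum_nonmultiples3; apply: eq_bigr => n _; rewrite Tn.
have sum1 : \sum_x g x = 17.
  by rewrite (sum_ZvE v1) sumv -sum_multiples3; apply: eq_bigr => n _; rewrite gE.
have sum2 : autocorr g 0 = 17.
  rewrite -sum1; apply: eq_bigr => y _; rewrite addr0 /g.
  by case: (3 %| y)%N; rewrite ?mulr1 ?mulr0.
have Sd d : autocorr S d = -1 + 51%:R *+ (d == 0).
  have := sds_autocorr Z v1 sds skA d; rewrite autocorr_indic /corr.
  rewrite (eq_card0 (A := [set _ in set0 | _])); last by move=> y; rewrite !inE.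
  have vZ : v%:R = 51%:R :> Z by rewrite v51.
  by rewrite mulr0 addr0 r25 l12 vZ => ->; congr (_ + _ *+ _).
(* The energy of [T] from the autocorrelation [51 [d = 0] - 1] of [S]; the right side is 34 * 17. *)
have H : 34 * T 1 ^+ 2 = - (17 * 17) + 51 * 17.
  rewrite -sumT sum_conv_sqr; under eq_bigr => d _ do rewrite Sd mulrDl mulN1r.
  rewrite big_split sumrN autocorr_ge sum1 -expr2; congr (_ + _).
  rewrite (bigD1 0) // eqxx mulr1n sum2 big1 ?addr0 // => d /negbTE ->.
  by rewrite mul0r.
apply: (@sqr_ne17 (T 1)); rewrite -expr2; move: H; move: (T 1 ^+ 2) => a; lia.
Qed.

(** * The parameters with v at most 51 *)

Definition sds_params : seq (nat * nat * nat) :=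
  [:: (3, 0, 0); (7, 0, 1); (7, 1, 1); (11, 0, 2); (11, 1, 2); (13, 3, 3); (15, 0, 3);
  (15, 1, 3); (19, 0, 4); (19, 1, 4); (21, 6, 6); (23, 0, 5); (23, 1, 5); (25, 4, 6);
  (27, 0, 6); (27, 1, 6); (29, 7, 8); (31, 0, 7); (31, 1, 7); (31, 6, 8); (31, 10, 10);
  (35, 0, 8); (35, 1, 8); (37, 10, 11); (39, 0, 9); (39, 1, 9); (41, 5, 10);
  (43, 0, 10); (43, 1, 10); (43, 7, 11); (43, 15, 15); (45, 11, 13); (47, 0, 11);
  (47, 1, 11); (49, 9, 13); (51, 0, 12); (51, 1, 12)]%N.

Local Open Scope Z_scope.

(* The entry for [e] lists [100 cos (2 pi j / e)] and [100 sin (2 pi j / e)], rounded. *)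
Definition trig_table : seq (nat * seq Z * seq Z) := [::
  (3%N, [:: 100; -50; -50],
    [:: 0; 87; -87]);
  (5%N, [:: 100; 31; -81; -81; 31],
    [:: 0; 95; 59; -59; -95]);
  (7%N, [:: 100; 62; -22; -90; -90; -22; 62],
    [:: 0; 78; 97; 43; -43; -97; -78]);
  (9%N, [:: 100; 77; 17; -50; -94; -94; -50; 17; 77],
    [:: 0; 64; 98; 87; 34; -34; -87; -98; -64]);
  (11%N, [:: 100; 84; 42; -14; -66; -96; -96; -66; -14; 42; 84],
    [:: 0; 54; 91; 99; 76; 28; -28; -76; -99; -91; -54]);
  (13%N, [:: 100; 89; 57; 12; -36; -75; -97; -97; -75; -36; 12; 57; 89],
    [:: 0; 46; 82; 99; 94; 66; 24; -24; -66; -94; -99; -82; -46]);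
  (15%N, [:: 100; 91; 67; 31; -10; -50; -81; -98; -98; -81; -50; -10; 31; 67; 91],
    [:: 0; 41; 74; 95; 99; 87; 59; 21; -21; -59; -87; -99; -95; -74; -41]);
  (19%N, [:: 100; 95; 79; 55; 24; -8; -40; -68; -88; -99; -99; -88; -68; -40; -8; 24;
  55; 79; 95],
    [:: 0; 32; 61; 84; 97; 100; 92; 74; 48; 16; -16; -48; -74; -92; -100; -97; -84;
    -61; -32]);
  (21%N, [:: 100; 96; 83; 62; 36; 7; -22; -50; -73; -90; -99; -99; -90; -73; -50; -22;
  7; 36; 62; 83; 96],
    [:: 0; 29; 56; 78; 93; 100; 97; 87; 68; 43; 15; -15; -43; -68; -87; -97; -100; -93;
    -78; -56; -29]);
  (23%N, [:: 100; 96; 86; 68; 46; 20; -7; -33; -58; -77; -92; -99; -99; -92; -77; -58;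
  -33; -7; 20; 46; 68; 86; 96],
    [:: 0; 27; 52; 73; 89; 98; 100; 94; 82; 63; 40; 14; -14; -40; -63; -82; -94; -100;
    -98; -89; -73; -52; -27]);
  (25%N, [:: 100; 97; 88; 73; 54; 31; 6; -19; -43; -64; -81; -93; -99; -99; -93; -81;
  -64; -43; -19; 6; 31; 54; 73; 88; 97],
    [:: 0; 25; 48; 68; 84; 95; 100; 98; 90; 77; 59; 37; 13; -13; -37; -59; -77; -90;
    -98; -100; -95; -84; -68; -48; -25]);
  (27%N, [:: 100; 97; 89; 77; 60; 40; 17; -6; -29; -50; -69; -83; -94; -99; -99; -94;
  -83; -69; -50; -29; -6; 17; 40; 60; 77; 89; 97],
    [:: 0; 23; 45; 64; 80; 92; 98; 100; 96; 87; 73; 55; 34; 12; -12; -34; -55; -73;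
    -87; -96; -100; -98; -92; -80; -64; -45; -23]);
  (29%N, [:: 100; 98; 91; 80; 65; 47; 27; 5; -16; -37; -56; -73; -86; -95; -100; -100;
  -95; -86; -73; -56; -37; -16; 5; 27; 47; 65; 80; 91; 98],
    [:: 0; 21; 42; 61; 76; 88; 96; 100; 99; 93; 83; 69; 52; 32; 11; -11; -32; -52; -69;
    -83; -93; -99; -100; -96; -88; -76; -61; -42; -21]);
  (31%N, [:: 100; 98; 92; 82; 69; 53; 35; 15; -5; -25; -44; -61; -76; -88; -95; -100;
  -100; -95; -88; -76; -61; -44; -25; -5; 15; 35; 53; 69; 82; 92; 98],
    [:: 0; 20; 39; 57; 72; 85; 94; 99; 100; 97; 90; 79; 65; 49; 30; 10; -10; -30; -49;
    -65; -79; -90; -97; -100; -99; -94; -85; -72; -57; -39; -20]);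
  (35%N, [:: 100; 98; 94; 86; 75; 62; 47; 31; 13; -4; -22; -39; -55; -69; -81; -90;
  -96; -100; -100; -96; -90; -81; -69; -55; -39; -22; -4; 13; 31; 47; 62; 75; 86; 94;
  98],
    [:: 0; 18; 35; 51; 66; 78; 88; 95; 99; 100; 97; 92; 83; 72; 59; 43; 27; 9; -9; -27;
    -43; -59; -72; -83; -92; -97; -100; -99; -95; -88; -78; -66; -51; -35; -18]);
  (37%N, [:: 100; 99; 94; 87; 78; 66; 53; 37; 21; 4; -13; -29; -45; -59; -72; -83; -91;
  -97; -100; -100; -97; -91; -83; -72; -59; -45; -29; -13; 4; 21; 37; 53; 66; 78; 87;
  94; 99],
    [:: 0; 17; 33; 49; 63; 75; 85; 93; 98; 100; 99; 96; 89; 80; 69; 56; 41; 25; 8; -8;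
    -25; -41; -56; -69; -80; -89; -96; -99; -100; -98; -93; -85; -75; -63; -49; -33;
    -17]);
  (39%N, [:: 100; 99; 95; 89; 80; 69; 57; 43; 28; 12; -4; -20; -36; -50; -63; -75; -85;
  -92; -97; -100; -100; -97; -92; -85; -75; -63; -50; -36; -20; -4; 12; 28; 43; 57; 69;
  80; 89; 95; 99],
    [:: 0; 16; 32; 46; 60; 72; 82; 90; 96; 99; 100; 98; 94; 87; 77; 66; 53; 39; 24; 8;
    -8; -24; -39; -53; -66; -77; -87; -94; -98; -100; -99; -96; -90; -82; -72; -60;
    -46; -32; -16]);
  (41%N, [:: 100; 99; 95; 90; 82; 72; 61; 48; 34; 19; 4; -12; -27; -41; -54; -67; -77;
  -86; -93; -97; -100; -100; -97; -93; -86; -77; -67; -54; -41; -27; -12; 4; 19; 34;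
  48; 61; 72; 82; 90; 95; 99],
    [:: 0; 15; 30; 44; 58; 69; 80; 88; 94; 98; 100; 99; 96; 91; 84; 75; 64; 51; 37; 23;
    8; -8; -23; -37; -51; -64; -75; -84; -91; -96; -99; -100; -98; -94; -88; -80; -69;
    -58; -44; -30; -15]);
  (43%N, [:: 100; 99; 96; 91; 83; 74; 64; 52; 39; 25; 11; -4; -18; -32; -46; -58; -69;
  -79; -87; -93; -98; -100; -100; -98; -93; -87; -79; -69; -58; -46; -32; -18; -4; 11;
  25; 39; 52; 64; 74; 83; 91; 96; 99],
    [:: 0; 15; 29; 42; 55; 67; 77; 85; 92; 97; 99; 100; 98; 95; 89; 81; 72; 61; 49; 36;
    22; 7; -7; -22; -36; -49; -61; -72; -81; -89; -95; -98; -100; -99; -97; -92; -85;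
    -77; -67; -55; -42; -29; -15]);
  (45%N, [:: 100; 99; 96; 91; 85; 77; 67; 56; 44; 31; 17; 3; -10; -24; -37; -50; -62;
  -72; -81; -88; -94; -98; -100; -100; -98; -94; -88; -81; -72; -62; -50; -37; -24;
  -10; 3; 17; 31; 44; 56; 67; 77; 85; 91; 96; 99],
    [:: 0; 14; 28; 41; 53; 64; 74; 83; 90; 95; 98; 100; 99; 97; 93; 87; 79; 69; 59; 47;
    34; 21; 7; -7; -21; -34; -47; -59; -69; -79; -87; -93; -97; -99; -100; -98; -95;
    -90; -83; -74; -64; -53; -41; -28; -14]);
  (47%N, [:: 100; 99; 96; 92; 86; 79; 70; 59; 48; 36; 23; 10; -3; -17; -30; -42; -54;
  -65; -74; -82; -89; -94; -98; -100; -100; -98; -94; -89; -82; -74; -65; -54; -42;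
  -30; -17; -3; 10; 23; 36; 48; 59; 70; 79; 86; 92; 96; 99],
    [:: 0; 13; 26; 39; 51; 62; 72; 81; 88; 93; 97; 99; 100; 99; 96; 91; 84; 76; 67; 57;
    45; 33; 20; 7; -7; -20; -33; -45; -57; -67; -76; -84; -91; -96; -99; -100; -99;
    -97; -93; -88; -81; -72; -62; -51; -39; -26; -13]);
  (49%N, [:: 100; 99; 97; 93; 87; 80; 72; 62; 52; 41; 28; 16; 3; -10; -22; -35; -46;
  -57; -67; -76; -84; -90; -95; -98; -100; -100; -98; -95; -90; -84; -76; -67; -57;
  -46; -35; -22; -10; 3; 16; 28; 41; 52; 62; 72; 80; 87; 93; 97; 99],
    [:: 0; 13; 25; 38; 49; 60; 70; 78; 86; 91; 96; 99; 100; 100; 97; 94; 89; 82; 74;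
    65; 55; 43; 32; 19; 6; -6; -19; -32; -43; -55; -65; -74; -82; -89; -94; -97; -100;
    -100; -99; -96; -91; -86; -78; -70; -60; -49; -38; -25; -13])].

Local Close Scope Z_scope.

(* A skew set modulo 43, not equivalent to the Paley set, which satisfies the
  spectral bound for the parameters [(43; 21, 15; 15)]. *)
Definition exceptional_43 : seq nat :=
  [:: 2; 3; 5; 9; 10; 11; 12; 13; 15; 16; 17; 20; 21; 24; 25; 29; 35; 36; 37; 39;
  42]%N.

(** As [cos(a - b) - cos(a + b) = 2 sin a sin b], the pair of cosines and sines of order [e] has
    [odd_corr] close to [10^4 v sin(2 pi y / e)]; dividing by [v c] leaves [10^4 / c] times the
    sine. *)
Definition tables (v : nat) (c : Z) : seq (Z * seq Z * seq Z) :=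
  [seq (Z.mul (Z.of_nat v) c, e.1.2, e.2) | e <- rev trig_table & e.1.1 %| v]%N.

Definition targets (v : nat) : seq (seq nat) :=
  undup [seq e.1.2 | e <- sds_table & e.1.1.1.1.1 == v]
    ++ (if v == 43%N then [:: exceptional_43] else [::]).

(* This is [4n - 1]; a one-element [B] can be replaced by the empty set. *)
Definition shift_bound (v k l : nat) : nat :=
  (4 * (v./2 + (if k == 1 then 0 else k) - l)).-1.

(** The search for [A] depends on [k] and [lambda] only through this bound, so one search per [v]
    with the largest value serves all parameters. *)
Definition max_bound (v : nat) : nat :=
  foldr maxn 0%N [seq shift_bound p.1.1 p.1.2 p.2 | p <- sds_params & p.1.1 == v].

(* A difference [d] with as few occurrences in [B] as possible, but at least one. *)
Definition best_diff (v : nat) (P : seq nat) : nat :=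
  head 1%N (flatten [seq [seq d <- iota 1 v./2 | nth 0%N P d == p] | p <- iota 1 v]).

Definition orders : seq nat :=
  [:: 3; 7; 11; 13; 15; 19; 21; 23; 25; 27; 29; 31; 35; 37; 39; 41; 43; 45; 47; 49]%N.

(** Coarse weights, about 100 times a sine, keep the diagrams small. The fine test has weights of
    about 5000 times a sine and uses the characters of order [v], which head the reversed table. *)
Lemma skew_ok_all :
  all (fun v => skew_search v (Z.of_nat (max_bound v)) (tables v (Z.of_nat 100))
    (head (Z0, [::], [::]) (tables v (Z.of_nat 2))) (targets v)) orders.
Proof. by vm_cast_no_check (@erefl bool true). Qed.

(** Where the table has no entry for [v], [k], [T], the acceptance test is constantly false, so
    success means that no [B] exists. *)
Lemma complement_ok_all :
  all (fun p => let: (v, k, l) := p in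
    all (fun T => complement_search v k l (best_diff v (budgets v l T)) T (accept_table v k T))
      (targets v)) [seq p <- sds_params | p != (43, 15, 15)%N].
Proof. by vm_cast_no_check (@erefl bool true). Qed.

Lemma max_bound_ok :
  all (fun p => shift_bound p.1.1 p.1.2 p.2 <= max_bound p.1.1)%N sds_params.
Proof. by vm_compute. Qed.

(** The counting identity determines [l] from [m] and [k], which leaves finitely many pairs to
    test. *)
Lemma sds_params_complete m k l :
  (0 < m <= 25)%N -> (k <= m)%N -> (k <= l)%N -> (l * m.*2 + m + k = m ^ 2 + k ^ 2)%N ->
  ((m.*2).+1, k, l) \in sds_params.
Proof.
move=> m1 km kl E.
have H : all (fun m => all (fun k =>
    let l := ((m * m + k * k - m - k) %/ m.*2)%N in
    (m * m + k * k - m - k == l * m.*2) && (k <= l) ==> (((m.*2).+1, k, l) \in sds_params))%N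
    (iota 0 m.+1)) (iota 1 25).
  by vm_compute.
have /(allP H) /allP/(_ k) : m \in iota 1 25 by rewrite mem_iota; lia.
rewrite mem_iota => /(_ km).
have XE : (m * m + k * k - m - k = l * m.*2)%N by move: E; rewrite -!mulnn; lia.
cbv zeta; rewrite XE mulnK; first by rewrite eqxx kl; apply.
by rewrite double_gt0; case/andP: m1.
Qed.

Lemma zdvd_modulo a b : Z.eqb (Z.modulo b a) Z0 -> a != 0 -> zdvd a b.
Proof.
move=> /Z.eqb_spec H /eqP a0; exists (Z.div b a); move: (Z.div_mod b a a0).
by rewrite H Z.add_0_r Z.mul_comm.
Qed.

Lemma zdvd_modulo_inv a b : a != 0 -> zdvd a b -> Z.modulo b a = Z0.
Proof. by move=> /eqP a0 [k ->]; exact: Z.mod_mul. Qed.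

Lemma natrZE n : n%:R = Z.of_nat n :> Z.
Proof. by elim: n => // n IH; rewrite -addn1 natrD IH Nat2Z.inj_add. Qed.

(** * The parameters (43; 21, 15; 15) *)

Section Order43.
Variables (v r : nat) (B : {set 'Z_v}).
Hypothesis v43 : v = 43%N.

Let v_gt1 : (1 < v)%N. Proof. by rewrite v43. Qed.
Let v_odd : odd v. Proof. by rewrite v43. Qed.

Definition corr_values (T : seq nat) : seq nat :=
  15%N :: [seq (15 - seq_corr 43 T d)%N | d <- iota 1 42].

Lemma corr_valuesE T : uniq T -> all (fun x => x < 43)%N T ->
  is_sds r 15 15 (residues v T) B ->
  forall d, (d < 43)%N -> corr B (d%:R : 'Z_v) = nth 0%N (corr_values T) d.
Proof.
move=> uT Tv [_ cB H] [|d] dv; first by rewrite corr0.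
have d0 : d.+1%:R != 0 :> 'Z_v by apply: nonzero_small => //; rewrite v43.
have := H _ d0; rewrite !diff_countE seq_corrE //; last by rewrite v43.
rewrite {1}v43 -nth_behead (nth_map 0%N) ?size_iota // nth_iota // add1n; lia.
Qed.

(** The quadratic nonresidues modulo 43; each nonzero difference occurs 10 times, leaving the odd
    count 5 for [B]. *)
Definition paley_43 : seq nat := head [::] (targets 43).

Lemma no_complement_paley_43 : ~ is_sds r 15 15 (residues v paley_43) B.
Proof.
move=> sds; have [_ cB _] := sds.
have cE := corr_valuesE _ _ sds.
have oc d : d != 0 -> odd (corr B d).
  move=> d0; rewrite -[d]natr_Zp cE //; last by rewrite -v43 -[X in (_ < X)%N]Zp_cast.
  have : all odd (corr_values paley_43) by vm_cast_no_check (@erefl bool true).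
  move/all_nthP; apply; rewrite -[size _]/43%N.
  by rewrite -v43 -[X in (_ < X)%N]Zp_cast.
(* Here 2 ^ 7 = 128 = 3 * 43 - 1. The block would be the whole group, against its size 15. *)
have all_in := @self_conjugate_const v 7 v_gt1 isT _ B _ oc.
have : #|B| = #|[set: 'Z_v]|.
  by apply: eq_card => x; rewrite all_in ?cB ?v43 ?inE.
by rewrite cB cardsT (card_Zv v_gt1) v43.
Qed.

Lemma no_complement_exceptional_43 : ~ is_sds r 15 15 (residues v exceptional_43) B.
Proof.
move=> sds; have cE := corr_valuesE (isT : uniq exceptional_43) isT sds.
(* As [l] is [-1] modulo 43, the primes above [l] of the real subfield of the field
  of 43rd roots of unity are inert.  Here [t = z + z^-1] with [z] of order 43 modulo
  [l^2], and [r0] is the Fourier coefficient at [z] of the difference counts; it is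
  exactly divisible by [l]. *)
pose l := Z.to_nat (Zpos 39301%positive); pose L := Z.of_nat l.
pose t : Z := Zneg 42697482%positive; pose r0 : Z := Zpos 967551319%positive.
have L0 : L * L != 0 by vm_cast_no_check (@erefl bool true).
have pl : prime l by vm_cast_no_check (@erefl bool true).
apply: (@no_exact_inert_factor v l t v_gt1 pl _ _ _ _ B r0).
- by rewrite v43; apply: zdvd_modulo L0; vm_cast_no_check (@erefl bool true).
- by rewrite v43; apply: zdvd_modulo L0; vm_cast_no_check (@erefl bool true).
- by rewrite v43; vm_cast_no_check (@erefl bool true).
- have L1 : L != 0 by vm_cast_no_check (@erefl bool true).
  move/(zdvd_modulo_inv L1)/Z.eqb_spec; apply/negP; by vm_cast_no_check (@erefl bool true).
- by apply: zdvd_modulo; vm_cast_no_check (@erefl bool true).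
- move/(zdvd_modulo_inv L0)/Z.eqb_spec; apply/negP; by vm_cast_no_check (@erefl bool true).
have -> : \sum_(d : 'Z_v) (corr B d)%:R * (lucas t (nat_of_ord d)).1 =
   zsum (fun d => Z.of_nat (nth 0%N (corr_values exceptional_43) d) * (lucas t d).1 : Z)
     (iota 0 43).
  have -> : iota 0 43 = index_iota 0 v by rewrite v43.
  rewrite (sum_ZvE v_gt1) zsumE; apply: eq_big_nat => d /andP[_ dv].
  by rewrite (val_natr_Zv v_gt1) (modn_small dv) natrZE cE -?v43.
by apply: zdvd_modulo L0; vm_cast_no_check (@erefl bool true).
Qed.

Lemma no_complement_43 T : T \in targets 43 -> ~ is_sds r 15 15 (residues v T) B.
Proof.
have -> : targets 43 = [:: paley_43; exceptional_43].
  by vm_cast_no_check (@erefl (seq (seq nat)) (targets 43)).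
rewrite !inE => /orP[] /eqP->; first exact: no_complement_paley_43.
exact: no_complement_exceptional_43.
Qed.

End Order43.

(** * Reduction of the classification to the searches *)

Lemma sds_params_order v k l : (v, k, l) \in sds_params ->
  [/\ (2 < v)%N, odd v & if v == 51%N then (k <= 1)%N else v \in orders].
Proof.
have H : all (fun p => [&& 2 < p.1.1, odd p.1.1 &
    if p.1.1 == 51 then p.1.2 <= 1 else p.1.1 \in orders])%N sds_params by vm_compute.
by move/(allP H)/and3P.
Qed.

Lemma shift_bound_le v k l : (v, k, l) \in sds_params -> (shift_bound v k l <= max_bound v)%N.
Proof. by move/(allP max_bound_ok). Qed.

Lemma targets_uniq v T : v \in orders -> T \in targets v -> uniq T /\ all (fun x => x < v)%N T.
Proof.
have H : all (fun v => all (fun T => uniq T && all (fun x => x < v)%N T) (targets v)) orders.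
  by vm_cast_no_check (@erefl bool true).
by move/(allP H)/allP => Hv /Hv /andP.
Qed.

Lemma is_sds_empty v r k l (A B : {set 'Z_v}) : (k <= 1)%N -> is_sds r k l A B ->
  is_sds r 0 l A set0.
Proof.
move=> k1 [cA cB H]; split=> //; first exact: cards0.
move=> i i0; rewrite -(H i i0) !diff_countE; congr (_ + _)%N.
rewrite /corr !eq_card0 // => x; rewrite !inE //; apply/negP => /andP[xB xiB].
have /card_le1_eqP/(_ _ _ xB xiB) /eqP : (#|B| <= 1)%N by rewrite cB.
by move/eqP=> E; move: i0; rewrite -(addKr x i) E addNr eqxx.
Qed.

Section Classification.
Variables (v r k l : nat) (A B : {set 'Z_v}).
Hypotheses (params : (v, k, l) \in sds_params) (sds : is_sds r k l A B).
Hypotheses (skA : skew_set A) (A1 : 1 \in A).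

Let v_gt2 : (2 < v)%N. Proof. by case: (sds_params_order params). Qed.
Let v_gt1 : (1 < v)%N. Proof. exact: ltnW. Qed.
Let v_odd : odd v. Proof. by case: (sds_params_order params). Qed.

Lemma order_in_orders : v \in orders.
Proof.
have [_ _] := sds_params_order params; case: eqP => // v51 k1.
by case: (no_paley_51 v51 (is_sds_empty k1 sds)).
Qed.

Lemma dilate_to_target : exists2 T, T \in targets v &
  exists d, [/\ (0 < d < v)%N, coprime d v & dilate d A = residues v T].
Proof.
(* A one-element block has no nonzero difference; emptying it sharpens the spectral bound on [A]. *)
have [k' [B' [sds' k'E]]] : exists k' B', is_sds r k' l A B' /\ k' = (if k == 1 then 0 else k)%N.
  case: eqP => [k1|_]; last by exists k, B.
  by exists 0%N, set0; split=> //; apply: is_sds_empty sds; rewrite k1.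
apply: (skew_searchP (allP skew_ok_all _ order_in_orders) v_gt2 v_odd sds' skA A1).
have := shift_bound_le params; rewrite /shift_bound -k'E.
have -> : r = v./2 by case: sds => <- _ _; rewrite skew_card.
rewrite !natrZE; move: (max_bound v) => M; lia.
Qed.

Lemma sds_classification : exists (r0 k0 l0 : nat) (s t : seq nat),
  [/\ ((v, r0, k0, l0), s, t) \in sds_table,
      is_sds r0 k0 l0 (residues v s) (residues v t) &
      sds_equiv (A, B) (residues v s, residues v t)].
Proof.
have [T Tin [d [dv cd dA]]] := dilate_to_target.
have cvd : coprime v d by rewrite coprime_sym.
have sdsT : is_sds r k l (residues v T) (dilate d B).
  by rewrite -dA; apply: is_sds_dilate sds.
have [uT Tv] := targets_uniq order_in_orders Tin.
have [|ne] := eqVneq (v, k, l) (43, 15, 15)%N.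
  case=> v43 k15 l15; case: (@no_complement_43 v r (dilate d B) v43 T).
    by rewrite -v43.
  by rewrite -{1}k15 -{1}l15.
have pin : (v, k, l) \in [seq p <- sds_params | p != (43, 15, 15)%N].
  by rewrite mem_filter ne.
have /allP/(_ _ Tin) cs := allP complement_ok_all _ pin.
have [a [s [acc us sv sE]]] := complement_searchP v_gt1 v_odd cs uT Tv sdsT.
have [t E {}acc] := accept_tableP acc; have [r0 [l0 [tin ok]]] := table_entryP E.
have [sds0 _ ut _ tv] := entry_ok_sds ok.
exists r0, k, l0, T, t; split=> //.
apply: (@sds_equiv_trans _ _ (residues v T, dilate d B)).
  by rewrite -dA; apply: rst_step; apply: Sds_dilate.
apply: (@sds_equiv_trans _ _ (residues v T, residues v s)).
  by rewrite sE; apply: sds_equiv_translate.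
exact: accept_entryP.
Qed.

End Classification.

Theorem theorem9 (v r k lambda : nat) (A B : {set 'Z_v}) :
  (2 < v)%N -> (v <= 51)%N -> odd v ->
  is_sds r k lambda A B ->
  skew_symmetric_sds A B ->
  2 <= 4 * (r%:Z + k%:Z - lambda%:Z) ->
  1 <= 2 * (v%:Z - 2 * (r%:Z + k%:Z - lambda%:Z)) ->
  exists (r0 k0 lambda0 : nat) (s t : seq nat),
    [/\ ((v, r0, k0, lambda0), s, t) \in sds_table,
        is_sds r0 k0 lambda0 (residues v s) (residues v t) &
        sds_equiv (A, B) (residues v s, residues v t)].
Proof.
move=> v2 v51 vo sds /skew_symmetric_sdsE skA n0 n1.
have v1 : (1 < v)%N := ltnW v2.
have rE : r = v./2 by case: sds => <- _ _; rewrite skew_card.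
(* Complementing [B] turns [k] into [v - k] and [lambda] into [lambda + v - 2 k], which leaves
   [r + k - lambda] unchanged. *)
wlog kv : k lambda B sds n0 n1 / (k <= v./2)%N.
  move=> IH; case: (leqP k v./2) => [|kv]; first exact: IH sds n0 n1.
  have kv' : (k <= v)%N by case: sds => _ <- _; have := max_card (mem B); rewrite card_Zv.
  have kl : (2 * k <= v + lambda)%N by lia.
  have sds' := is_sds_setC v1 vo sds kv' kl.
  have [|||r0 [k0 [l0 [s [t [tin s0 eq]]]]]] := IH _ _ _ sds'; try lia.
  exists r0, k0, l0, s, t; split=> //.
  by apply: sds_equiv_trans eq; apply: rst_step; apply: Sds_compl_r.
(* Otherwise -1 lies in [A], and both blocks are dilated by [v - 1]. *)
wlog A1 : A B sds skA / 1 \in A.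
  move=> IH; have [|A1] := boolP (1 \in A); first exact: IH sds skA.
  have cv : coprime v v.-1 by rewrite coprime_sym coprimePn; lia.
  have [|r0 [k0 [l0 [s [t [tin s0 eq]]]]]] :=
    IH _ _ (is_sds_dilate v1 cv sds) (skew_dilate v1 cv skA).
    by rewrite dilateN1 // (proj2 skA) ?oner_eq0.
  exists r0, k0, l0, s, t; split=> //; apply: sds_equiv_trans eq; apply: rst_step.
  by apply: Sds_dilate; rewrite 1?coprime_sym //; lia.
(* With [v = 2 r + 1] the hypothesis [n1] amounts to [k <= lambda]. *)
have params : (v, k, lambda) \in sds_params.
  have vE : (v./2.*2.+1 = v)%N by lia.
  have := is_sds_card v1 sds; rewrite rE (_ : v.-1 = v./2.*2)%N; last by lia.
  move=> E; have := @sds_params_complete v./2 k lambda; rewrite vE.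
  by apply=> //; lia.
exact: sds_classification params sds skA A1.
Qed.
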